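(* Let $\mathcal{A}$ be an $S$-ring of rank $4$ over a finite cyclic group $G$. Then one of the following holds: (1) $\mathcal{A}=\mathcal{T}_L\otimes\mathcal{T}_U$ for nontrivial $\mathcal{A}$-subgroups $L,U$ with $G=L\times U$ (i.e. the basic sets are $\{e\}$, $L^\#$, $U^\#$, $L^\#U^\#$); (2) $\mathcal{A}=(\mathcal{T}_L\wr\mathcal{T}_{U/L})\wr\mathcal{T}_{G/U}$ for nontrivial $\mathcal{A}$-subgroups $L<U$ (i.e. the basic sets are $\{e\}$, $L^\#$, $U\setminus L$, $G\setminus U$); (3) $\mathcal{A}=\mathrm{Cyc}(\frac{p-1}{2},L)\wr\mathcal{T}_{G/L}$ for a nontrivial $\mathcal{A}$-subgroup $L$ of prime order $p\ge 3$; (4) $\mathcal{A}=\mathcal{T}_L\wr\mathrm{Cyc}(\frac{p-1}{2},G/L)$ for a nontrivial $\mathcal{A}$-subgroup $L$ of prime index $p\ge 3$; (5) $|G|=p$ for a prime $p\equiv 1\pmod 3$ and $\mathcal{A}=\mathrm{Cyc}(\frac{p-1}{3},G)$; (6) $|G|=4$ and $\mathcal{A}=\mathbb{Z}G$.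
   Context: Let $G$ be a finite group with identity $e$, $H^\#=H\setminus\{e\}$, and for $X\subseteq G$ let $\underline{X}=\sum_{x\in X}x\in\mathbb{Z}G$. An $S$-ring over $G$ is a subring $\mathcal{A}\subseteq\mathbb{Z}G$ for which there is a partition $\mathcal{S}(\mathcal{A})$ of $G$ (the basic sets) with $\{e\}\in\mathcal{S}(\mathcal{A})$, $X\in\mathcal{S}(\mathcal{A})\Rightarrow X^{-1}\in\mathcal{S}(\mathcal{A})$, and $\mathcal{A}=\mathrm{Span}_{\mathbb{Z}}\{\underline{X}:X\in\mathcal{S}(\mathcal{A})\}$; its rank is $|\mathcal{S}(\mathcal{A})|$. A subgroup $H$ is an $\mathcal{A}$-subgroup if $\underline{H}\in\mathcal{A}$; it is nontrivial if $\{e\}<H<G$. For $\mathcal{A}$-subgroups $L\trianglelefteq U$, $\mathcal{A}_{U/L}$ is the $S$-ring over $U/L$ spanned by the images of the basic sets contained in $U$ under $U\to U/L$, and $\mathcal{A}_U=\mathcal{A}_{U/\{e\}}$. $\mathcal{T}_H$ is the $S$-ring over $H$ with basic sets $\{e\},H^\#$; $\mathbb{Z}G$ is the $S$-ring with all basic sets singletons. For $K\le\mathrm{Aut}(H)$, $\mathrm{Cyc}(K,H)$ is the $S$-ring over $H$ whose basic sets are the $K$-orbits; if $|H|=p$ is prime and $k\mid p-1$, $\mathrm{Cyc}(k,H)=\mathrm{Cyc}(K,H)$ for the unique $K\le\mathrm{Aut}(H)$ of order $k$. If $G=H\times V$ with $H,V$ $\mathcal{A}$-subgroups, $\mathcal{A}=\mathcal{A}_H\otimes\mathcal{A}_V$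 means $\mathcal{S}(\mathcal{A})=\{X_1\times X_2:X_1\in\mathcal{S}(\mathcal{A}_H),X_2\in\mathcal{S}(\mathcal{A}_V)\}$. For a normal $\mathcal{A}$-subgroup $L$, $\mathcal{A}=\mathcal{A}_L\wr\mathcal{A}_{G/L}$ means $LX=XL=X$ for every basic set $X$ not contained in $L$. *)

(* Defs.v *)
From mathcomp Require Import all_boot fingroup morphism perm automorphism quotient action cyclic gproduct.
Set Implicit Arguments. Unset Strict Implicit. Unset Printing Implicit Defensive.
Import GroupScope.

Section SRing.
Variable gT : finGroupType.

(* S-ring over G, given by its set S of basic sets.  The span of the
   underlines of a partition S of G is exactly the set of Z-valued functions
   on G constant on the blocks of S; it contains e = underline {e} and is
   closed under addition, so it is a subring iff every product
   underline X * underline Y (X, Y in S) has coefficients constant on each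
   block Z of S; the coefficient of z is #{(x,y) in X*Y | x*y = z}. *)
Definition is_Sring (G : {set gT}) (S : {set {set gT}}) : Prop :=
  [/\ partition S G,
      [set 1] \in S,
      (forall X, X \in S -> X^-1 \in S)
    & forall X Y Z, X \in S -> Y \in S -> Z \in S ->
        forall z1 z2, z1 \in Z -> z2 \in Z ->
          #|[set xy in setX X Y | xy.1 * xy.2 == z1]|
          = #|[set xy in setX X Y | xy.1 * xy.2 == z2]| ].

Definition srank (S : {set {set gT}}) : nat := #|S|.

(* H is an A-subgroup: underline H lies in A, i.e. H is a union of basic sets *)
Definition Asubgroup (S : {set {set gT}}) (H : {set gT}) : Prop :=
  H = cover [set X in S | X \subset H].

Definition basic_in (S : {set {set gT}}) (U : {set gT}) : {set {set gT}} :=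
  [set X in S | X \subset U].

Definition basic_quo (S : {set {set gT}}) (L U : {set gT}) :
  {set {set coset_of L}} :=
  [set coset L @: X | X : {set gT} in basic_in S U].

(* A = A_L wr A_{G/L}: every basic set outside L is a union of L-cosets *)
Definition wreath_cond (S : {set {set gT}}) (L : {set gT}) : Prop :=
  forall X, X \in S -> ~~ (X \subset L) -> L * X = X /\ X * L = X.
End SRing.

(* Main.v *)
(** The argument splits on the lattice of A-subgroups. A chain [1 < L < U < G]
    or two complementary A-subgroups already account for four basic sets, which
    gives (2) and (1). An S-ring of rank at least 3 without nontrivial
    A-subgroups over a cyclic group has prime order (Schur), and over a prime
    order group the basic sets are the orbits of a group of automorphisms; this
    gives (5), and, applied to [L] or to [G / L], also (3) and (4). There
    remains the case of a single nontrivial A-subgroup [L] with [L^#] basic and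
    two outer basic sets [Y], [Z] where [Y] is not a union of [L]-cosets. Take
    [p] dividing [|L|] and [E] of order [p]: by Schur's theorem on [p]-th powers
    [Y] can fail to be [E]-invariant only at elements [y] with [y ^ p] in [L].
    For odd [p], a power map [x |-> x ^ m], [m] prime to [|G|], moves [y]
    inside [yE]; it permutes [{Y, Z}], so its square fixes [Y], and the powers
    of the square are already transitive on [yE]; for
    [p = 2] the squares of elements of [Y] cover [L^#], which forces [|L| = 2]
    and then [Y], [Z] to be singletons. *)

Require Import Defs.
From HB Require Import structures.
From mathcomp Require Import all_boot fingroup morphism perm automorphism quotient action cyclic gproduct.
From mathcomp Require Import ssralg zmodp pgroup.
Set Implicit Arguments. Unset Strict Implicit. Unset Printing Implicit Defensive.
Import GroupScope.

(** * The group algebra and its Frobenius map *)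

Section GroupAlgebra.
Import GRing.Theory.
Local Open Scope ring_scope.
Variables (gT : finGroupType) (R : nzRingType).

(** A separate name for the function type, so that its product can be convolution; only the additive
    structure is inherited. *)
Definition galg : Type := {ffun gT -> R}.
HB.instance Definition _ := GRing.Nmodule.on galg.
Implicit Types a b c : galg.

Definition galg_delta (x : gT) : galg := [ffun z => (z == x)%:R].
Definition galg_mul a b : galg := [ffun z => \sum_x a x * b (x^-1 * z)%g].

Lemma galg_mulA : associative galg_mul.
Proof.
move=> a b c; apply/ffunP=> z; rewrite !ffunE.
under eq_bigr do rewrite ffunE mulr_sumr.
under [RHS]eq_bigr do rewrite ffunE mulr_suml.
rewrite [RHS]exchange_big; apply: eq_bigr => x _ /=.
rewrite [RHS](reindex_inj (mulgI x)); apply: eq_bigr => y _ /=.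
by rewrite mulrA mulKg invMg mulgA.
Qed.

Lemma galg_mul_deltal x b z : galg_mul (galg_delta x) b z = b (x^-1 * z)%g.
Proof.
rewrite ffunE (bigD1 x) //= ffunE eqxx mul1r big1 ?addr0 // => y /negPf nyx.
by rewrite ffunE nyx mul0r.
Qed.

Lemma galg_mul1l : left_id (galg_delta 1%g) galg_mul.
Proof. by move=> b; apply/ffunP=> z; rewrite galg_mul_deltal invg1 mul1g. Qed.

Lemma galg_mul_deltar a y z : galg_mul a (galg_delta y) z = a (z * y^-1)%g.
Proof.
rewrite ffunE (bigD1 (z * y^-1)%g) //= ffunE invMg invgK mulgKV eqxx mulr1.
rewrite big1 ?addr0 // => x nx; rewrite ffunE.
case: (_ =P y) nx => [<-|_ _]; last by rewrite mulr0.
by rewrite invMg invgK mulKVg eqxx.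
Qed.

Lemma galg_mul1r : right_id (galg_delta 1%g) galg_mul.
Proof. by move=> b; apply/ffunP=> z; rewrite galg_mul_deltar invg1 mulg1. Qed.

Lemma galg_mulDl : left_distributive galg_mul +%R.
Proof.
move=> a b c; apply/ffunP=> z; rewrite !ffunE -big_split.
by apply: eq_bigr => x _; rewrite ffunE mulrDl.
Qed.

Lemma galg_mulDr : right_distributive galg_mul +%R.
Proof.
move=> a b c; apply/ffunP=> z; rewrite !ffunE -big_split.
by apply: eq_bigr => x _; rewrite ffunE mulrDr.
Qed.

Lemma galg_mul0l : left_zero 0 galg_mul.
Proof.
by move=> a; apply/ffunP=> z; rewrite !ffunE big1 // => x _; rewrite ffunE mul0r.
Qed.

Lemma galg_mul0r : right_zero 0 galg_mul.
Proof.
by move=> a; apply/ffunP=> z; rewrite !ffunE big1 // => x _; rewrite ffunE mulr0.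
Qed.

Lemma galg_delta_neq0 x : galg_delta x != 0.
Proof.
by apply/eqP=> /ffunP/(_ x)/eqP; rewrite !ffunE eqxx oner_eq0.
Qed.

HB.instance Definition _ := GRing.Nmodule_isNzSemiRing.Build galg
  galg_mulA galg_mul1l galg_mul1r galg_mulDl galg_mulDr galg_mul0l galg_mul0r
  (galg_delta_neq0 1%g).

Lemma galg_deltaM x y : galg_delta x * galg_delta y = galg_delta (x * y)%g.
Proof.
by apply/ffunP=> z; rewrite galg_mul_deltal !ffunE (can2_eq (mulKVg x) (mulKg x)).
Qed.

Lemma galg_deltaX x n : galg_delta x ^+ n = galg_delta (x ^+ n)%g.
Proof. by elim: n => // n IHn; rewrite exprS IHn galg_deltaM expgS. Qed.

Lemma galg_sumE I r (P : pred I) (F : I -> galg) z :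
  (\sum_(i <- r | P i) F i) z = \sum_(i <- r | P i) F i z.
Proof. exact: (sum_ffunE r P F z). Qed.

Lemma galg_pchar p : p \in [pchar R] -> p \in [pchar galg].
Proof.
case/andP=> p_pr /eqP p0; rewrite inE p_pr; apply/eqP/ffunP=> z.
have natE n : (n%:R : galg) z = n%:R * (z == 1%g)%:R.
  elim: n => [|n IHn]; first by rewrite ffunE mul0r.
  by rewrite !mulrS mulrDl mul1r -IHn !ffunE.
by rewrite natE p0 mul0r ffunE.
Qed.

Lemma galg_Frobenius p (X : {set gT}) : p \in [pchar R] ->
    {in X &, commutative mulg} ->
  (\sum_(x in X) galg_delta x) ^+ p = \sum_(x in X) galg_delta (x ^+ p)%g.
Proof.
move=> /galg_pchar pR cXX.
(* Additivity of the [p]-th power needs commuting summands, so the induction over [X] also carries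
   that the partial sum commutes with each delta function. *)
suff [_ ->] : (forall y, y \in X -> GRing.comm (galg_delta y) (\sum_(x in X) galg_delta x)) /\
   (\sum_(x in X) galg_delta x) ^+ p = \sum_(x in X) galg_delta (x ^+ p)%g by [].
rewrite -!big_enum; have: {subset enum X <= X} by move=> x; rewrite mem_enum.
elim: (enum X) => [|x s IHs] sX.
  rewrite !big_nil; split=> [y _|]; first exact: commr0.
  by rewrite -(pFrobenius_autE pR) pFrobenius_aut0.
have [|cs IH] := IHs; first by move=> y ys; apply: sX; rewrite inE ys orbT.
have Xx : x \in X by apply: sX; rewrite inE eqxx.
split=> [y Xy|].
  rewrite big_cons; apply: commrD; last exact: cs.
  by rewrite /GRing.comm !galg_deltaM cXX.
rewrite !big_cons -(pFrobenius_autE pR) pFrobenius_autD_comm; last exact: cs.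
by rewrite !(pFrobenius_autE pR) IH galg_deltaX.
Qed.

End GroupAlgebra.
Arguments galg_delta {gT} R x.

(** * Unions of basic sets *)

Lemma card_mul_fiber (gT : finGroupType) (X Y : {set gT}) (z : gT) :
  #|[set xy in setX X Y | xy.1 * xy.2 == z]| = #|[set x in X | x^-1 * z \in Y]|.
Proof.
rewrite -(card_imset [set x in X | _] (_ : injective (fun x => (x, x^-1 * z)))).
  apply: eq_card => -[x y]; rewrite !inE /=; apply/idP/imsetP=> [|[t]].
    case/andP=> /andP[Xx Yy] /eqP <-; exists x; last by rewrite mulKg.
    by rewrite inE Xx mulKg.
  by rewrite !inE => /andP[Xt Yt] [-> ->]; rewrite Xt Yt mulKVg eqxx.
by move=> x y [].
Qed.

Section AlgebraSets.
Variables (gT : finGroupType) (G : {group gT}) (S : {set {set gT}}).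
Hypothesis SR : is_Sring G S.
Implicit Types (X Y Z D : {set gT}) (H : {group gT}) (x y z : gT).

(** Unions of basic sets in elementwise form, the shape in which closure under set operations and
    products is easiest to check; [Asubgroup_Aset] links it to [Asubgroup]. *)
Definition is_Aset D :=
  D \subset G /\ forall X x y, X \in S -> x \in X -> y \in X -> x \in D -> y \in D.

Lemma basic_sub {X} : X \in S -> X \subset G.
Proof.
case: SR => /and3P[/eqP <- _ _] _ _ _ SX.
by apply/subsetP=> x Xx; apply/bigcupP; exists X.
Qed.

Lemma basic_n0 {X} : X \in S -> exists x, x \in X.
Proof.
case: SR => /and3P[_ _ S0] _ _ _ SX; apply/set0Pn.
by apply: contraNneq S0 => <-.
Qed.

Lemma basic_cover {x} : x \in G -> exists2 X, X \in S & x \in X.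
Proof. by case: SR => /and3P[/eqP <- _ _] _ _ _ /bigcupP[X]; exists X. Qed.

Lemma basic_eq {X Y x} : X \in S -> Y \in S -> x \in X -> x \in Y -> X = Y.
Proof.
case: SR => /and3P[_ /trivIsetP tS _] _ _ _ SX SY Xx Yx.
by apply: contraTeq Xx => /(tS _ _ SX SY)/disjointFl->.
Qed.

Lemma basic1 : [set 1] \in S. Proof. by case: SR. Qed.

Lemma basicV {X} : X \in S -> X^-1 \in S. Proof. by case: SR => _ _ + _; apply. Qed.

Lemma basic_not1 {X} : X \in S -> X != [set 1] -> 1 \notin X.
Proof. by move=> SX nX1; apply: contraNN nX1 => /(basic_eq basic1 SX (set11 1))->. Qed.

Lemma Aset_basic {X} : X \in S -> is_Aset X.
Proof.
move=> SX; split; first exact: basic_sub.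
by move=> Y x y SY Yx Yy Xx; rewrite (basic_eq SX SY Xx Yx).
Qed.

Lemma Aset_sub {D X x} : is_Aset D -> X \in S -> x \in X -> x \in D -> X \subset D.
Proof. by case=> _ hD SX Xx Dx; apply/subsetP=> y Xy; apply: (hD X x y). Qed.

Lemma Asubgroup_Aset {D} : Asubgroup S D <-> is_Aset D.
Proof.
split=> [-> | [sDG hD]].
  split=> [|X x y SX Xx Xy].
    apply/bigcupsP=> X; rewrite inE => /andP[SX _]; exact: basic_sub.
  case/bigcupP=> Y; rewrite inE => /andP[SY sYD] Yx.
  by apply/bigcupP; exists Y; rewrite ?inE ?SY // -(basic_eq SX SY Xx Yx).
apply/eqP; rewrite eqEsubset; apply/andP; split; last first.
  by apply/bigcupsP=> X; rewrite inE => /andP[].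
apply/subsetP=> x Dx; have [X SX Xx] := basic_cover (subsetP sDG x Dx).
by apply/bigcupP; exists X; rewrite ?inE ?SX //; apply: (Aset_sub _ SX Xx Dx).
Qed.

Lemma AsetG : is_Aset G.
Proof. by split=> // X x y SX _ Xy _; apply: (subsetP (basic_sub SX)). Qed.

Lemma AsetI {D1 D2} : is_Aset D1 -> is_Aset D2 -> is_Aset (D1 :&: D2).
Proof.
move=> [s1 h1] [s2 h2]; split=> [|X x y SX Xx Xy]; first exact: subIset (introT orP (or_introl s1)).
by rewrite !inE => /andP[/(h1 X x y SX Xx Xy)-> /(h2 X x y SX Xx Xy)->].
Qed.

Lemma AsetD {D1 D2} : is_Aset D1 -> is_Aset D2 -> is_Aset (D1 :\: D2).
Proof.
move=> [s1 h1] [s2 h2]; split=> [|X x y SX Xx Xy]; first exact: subset_trans (subsetDl _ _) s1.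
rewrite !inE => /andP[D2x D1x]; rewrite (h1 X x) // andbT.
by apply: contra D2x; apply: (h2 X).
Qed.

Lemma AsetU {D1 D2} : is_Aset D1 -> is_Aset D2 -> is_Aset (D1 :|: D2).
Proof.
move=> [s1 h1] [s2 h2]; split=> [|X x y SX Xx Xy]; first by rewrite subUset s1.
by rewrite !inE => /orP[/(h1 X x y SX Xx Xy)|/(h2 X x y SX Xx Xy)]->; rewrite ?orbT.
Qed.

(** The coefficient of [z] in a product of two basic sets is constant on the basic set of [z], so if
    one element of that set is a product, all are. *)
Lemma AsetM {D1 D2} : is_Aset D1 -> is_Aset D2 -> is_Aset (D1 * D2).
Proof.
move=> A1 A2; have [[s1 h1] [s2 h2]] := (A1, A2).
split=> [|Z z z' SZ Zz Zz']; first by rewrite mul_subG.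
case/mulsgP=> x y D1x D2y def_z.
have [X SX Xx] := basic_cover (subsetP s1 x D1x).
have [Y SY Yy] := basic_cover (subsetP s2 y D2y).
case: SR => _ _ _ /(_ X Y Z SX SY SZ z z' Zz Zz') eq_zz'.
have: 0 < #|[set xy in setX X Y | xy.1 * xy.2 == z']|.
  rewrite -eq_zz'; apply/card_gt0P; exists (x, y).
  by rewrite !inE Xx Yy def_z /=.
case/card_gt0P=> -[x' y']; rewrite !inE /= => /andP[/andP[Xx' Yy'] /eqP<-].
by rewrite mem_mulg //; [apply: (h1 X x) | apply: (h2 Y y)].
Qed.

Lemma Aset_gen {D} : is_Aset D -> is_Aset <<D>>.
Proof.
move=> AD; have [n ->] := gen_expgs D.
have A1 : is_Aset (1%g |: D) by apply/AsetU/AD/Aset_basic/basic1.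
elim: n => [|n IHn]; first exact/Aset_basic/basic1.
by rewrite expgS; apply: AsetM.
Qed.

(** [#|X :&: z *: X|] is the coefficient of [z] in the product of [X] and [X^-1]. *)
Lemma card_lcoset_cap {X Z z z'} : X \in S -> Z \in S -> z \in Z -> z' \in Z ->
  #|X :&: z *: X| = #|X :&: z' *: X|.
Proof.
have capE w : #|X :&: w *: X| = #|[set xy in setX X X^-1 | xy.1 * xy.2 == w]|.
  rewrite card_mul_fiber; apply: eq_card => x.
  by rewrite !inE mem_lcoset invMg invgK.
move=> SX SZ Zz Zz'; rewrite !capE.
by case: SR => _ _ _ /(_ X X^-1 Z SX (basicV SX) SZ z z' Zz Zz').
Qed.

(** The stabiliser of [X] under left translation; in an abelian group this is the usual radical of
    [X]. *)
Lemma radical_group_set X : group_set [set g in G | g *: X == X].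
Proof.
apply/group_setP; split=> [|g h]; first by rewrite !inE group1 lcoset1 /=.
rewrite !inE => /andP[Gg /eqP gX] /andP[Gh /eqP hX].
by rewrite groupM //= lcosetM hX gX.
Qed.
Definition radical X := Group (radical_group_set X).

(** An element stabilises [X] exactly when its coefficient in the product of [X] and [X^-1] is
    [#|X|], a condition constant on basic sets. *)
Lemma Aset_radical {X} : X \in S -> is_Aset (radical X).
Proof.
move=> SX; have radE g : (g *: X == X) = (#|X :&: g *: X| == #|X|).
  apply/eqP/eqP=> [->|cX]; first by rewrite setIid.
  apply/esym/eqP; rewrite eqEcard card_lcoset leqnn andbT.
  by apply/setIidPl/eqP; rewrite eqEcard subsetIl cX leqnn.
split=> [|Z z z' SZ Zz Zz']; first by apply/subsetP=> g; rewrite inE => /andP[].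
rewrite !inE !radE => /andP[_]; rewrite (card_lcoset_cap SX SZ Zz Zz') => ->.
by rewrite (subsetP (basic_sub SZ)).
Qed.

Lemma sub_radical X H : H \subset G ->
  (forall h x, h \in H -> x \in X -> h * x \in X) -> H \subset radical X.
Proof.
move=> sHG HX; apply/subsetP=> h Hh; rewrite inE (subsetP sHG) //=.
rewrite eqEcard card_lcoset leqnn andbT; apply/subsetP=> _ /lcosetP[x Xx ->].
exact: HX.
Qed.

Lemma radical_lcoset {X H} : H \subset radical X -> H * X = X.
Proof.
move=> /subsetP sH; apply/eqP; rewrite eqEsubset; apply/andP; split; last first.
  by apply/subsetP=> x Xx; rewrite -[x]mul1g mem_mulg.
apply/subsetP=> _ /mulsgP[h x /sH + Xx ->]; rewrite inE => /andP[_ /eqP hX].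
by rewrite -hX mem_lcoset mulKg.
Qed.

Lemma card_basic : #|G| = \sum_(X in S) #|X|.
Proof. by case: SR => /card_partition. Qed.

End AlgebraSets.

Arguments AsetG {gT G S}.

(** * Schur's theorems on power maps *)

Section SchurFrobenius.
Import GRing.Theory.
Variables (gT : finGroupType) (G : {group gT}) (S : {set {set gT}}).
Hypotheses (SR : is_Sring G S) (cGG : abelian G).

(** The two conditions on [f] say that it lies in the span of the basic sets over [R]. Multiplying
    by a basic set stays in the span, since the structure constants are the counts in [is_Sring]. *)
Lemma galg_conv_const {R : nzRingType} {X} (f : galg gT R) : X \in S ->
    {in ~: G, forall x, f x = 0%R} ->
    (forall Z, Z \in S -> {in Z &, forall z z', f z = f z'}) ->
  let g := (f * \sum_(x in X) galg_delta R x)%R in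
  {in ~: G, forall x, g x = 0%R} /\
  (forall Z, Z \in S -> {in Z &, forall z z', g z = g z'}).
Proof.
move=> SX f0 fS g.
have gE z : g z = (\sum_(x in X) f (z * x^-1)%g)%R.
  by rewrite /g mulr_sumr galg_sumE; apply: eq_bigr => x _; apply: galg_mul_deltar.
split=> [z Gz | Z SZ z z' Zz Zz'].
  rewrite gE big1 // => x Xx; apply: f0; rewrite !inE in Gz *.
  have Gx : x \in G by apply: (subsetP (basic_sub SR SX)).
  by rewrite groupMr ?groupV.
have g_sum w : w \in Z -> g w =
    (\sum_(Y in S) f (repr Y) *+ #|[set xy in setX Y X | (xy.1 * xy.2)%g == w]|)%R.
  move=> Zw; have Gw : w \in G by apply: (subsetP (basic_sub SR SZ)).
  have prS : partition S G by case: SR.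
  (* The sum becomes one over all [x] with [x^-1 * w] in [X], which is then cut along the basic sets
     containing [x]. *)
  rewrite gE (reindex_inj invg_inj) /=.
  rewrite (reindex_inj (mulgI w^-1)) /=.
  under eq_bigr do rewrite invgK mulKVg.
  rewrite big_mkcond (bigID (mem G)) /= [X in (_ + X)%R]big1 ?addr0; last first.
    by move=> x Gx; rewrite f0 ?inE // if_same.
  rewrite (set_partition_big _ prS) /=; apply: eq_bigr => Y SY.
  rewrite -big_mkcondr /= -sum1_card -sumrMnr.
  rewrite (reindex_onto (fun y => (y, y^-1 * w)) fst) /=; last first.
    by move=> [x y]; rewrite !inE /= => /andP[_ /eqP <-]; rewrite mulKg.
  apply: eq_big => [y|y /andP[Yy _]].
    by rewrite !inE /= mulKVg !eqxx !andbT invMg invgK.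
  by rewrite mulr1n; apply: (fS Y) => //; apply: mem_repr Yy.
rewrite !g_sum //; apply: eq_bigr => Y SY.
by case: SR => _ _ _ /(_ Y X Z SY SX SZ z z' Zz Zz')->.
Qed.

(* Over F_p the p-th power of the sum over [X] is the sum of the p-th powers,
   and it lies in the S-ring. *)
Lemma schur_pth_power {p X Z z z'} : prime p -> X \in S -> Z \in S -> z \in Z -> z' \in Z ->
  #|[set x in X | x ^+ p == z]| = #|[set x in X | x ^+ p == z']| %[mod p].
Proof.
move=> p_pr SX SZ Zz Zz'; pose R : nzRingType := 'F_p.
have pR : p \in [pchar R]%R by apply: pchar_Fp.
pose f : galg gT R := (\sum_(x in X) galg_delta R x)%R.
have fn n : {in ~: G, forall x, (f ^+ n)%R x = 0%R} /\
  (forall Z, Z \in S -> {in Z &, forall z z', (f ^+ n)%R z = (f ^+ n)%R z'}).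
  elim: n => [|n [IH0 IHS]]; last first.
    rewrite exprSr; exact: galg_conv_const.
  split=> [x Gx|W SW w w' Ww Ww'].
    by rewrite ffunE; case: eqP Gx => // ->; rewrite inE group1.
  have [W1 | nW1] := eqVneq W [set 1].
    by move: Ww Ww'; rewrite W1 => /set1P-> /set1P->.
  have W'1 := basic_not1 SR SW nW1.
  have Wn1 v : v \in W -> (v == 1) = false by move=> Wv; apply: contraNF W'1 => /eqP <-.
  by rewrite !ffunE !Wn1.
(* By the Frobenius map, the coefficient of [w] in [f ^+ p] counts the [p]-th roots of [w] in [X]
   modulo [p]. *)
have fpE w : ((f ^+ p)%R w = #|[set x in X | x ^+ p == w]%g|%:R)%R.
  rewrite /f galg_Frobenius // => [|x y Xx Xy]; last first.
    by apply: (centsP cGG); apply: (subsetP (basic_sub SR SX)).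
  rewrite galg_sumE -sum1_card natr_sum.
  rewrite big_mkcond [RHS]big_mkcond; apply: eq_bigr => x _.
  by rewrite ffunE inE eq_sym; case: (x \in X); case: (_ == _).
have := (fn p).2 Z SZ z z' Zz Zz'; rewrite !fpE => /(congr1 val).
by rewrite /= !val_Fp_nat.
Qed.

End SchurFrobenius.

(** * Power maps with exponent prime to the group order *)

Section Multipliers.
Variables (gT : finGroupType) (G : {group gT}) (S : {set {set gT}}).
Hypotheses (SR : is_Sring G S) (cGG : abelian G).
Implicit Types (X Y Z D : {set gT}) (x y z : gT).

(** The [p]-th power map is injective on [G], so [x ^+ p] has one [p]-th root in [X]. On its whole
    basic set the number of roots is then congruent to 1 modulo [p], hence nonzero. *)
Lemma Aset_prime_power {p D} : prime p -> coprime #|G| p -> is_Aset G S D ->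
  is_Aset G S [set x ^+ p | x in D].
Proof.
move=> p_pr co_p AD; have [sDG _] := AD; split=> [|Z z z' SZ Zz Zz' /imsetP[x Dx def_z]].
  by apply/subsetP=> _ /imsetP[x Dx ->]; rewrite groupX ?(subsetP sDG).
have Gx := subsetP sDG x Dx; have [X SX Xx] := basic_cover SR Gx; rewrite {z}def_z in Zz.
have sXD := Aset_sub AD SX Xx Dx.
have := schur_pth_power SR cGG p_pr SX SZ Zz Zz'.
have -> : [set t in X | t ^+ p == x ^+ p] = [set x].
  apply/setP=> t; rewrite !inE; apply/andP/eqP=> [[Xt /eqP tx]|->]; last by rewrite Xx.
  have Gt := subsetP (basic_sub SR SX) t Xt.
  by rewrite -(expgK co_p Gt) /= tx (expgK co_p Gx).
rewrite cards1 modn_small ?prime_gt1 // => eq1.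
have /card_gt0P[t] : 0 < #|[set t in X | t ^+ p == z']|.
  by rewrite lt0n; apply: contra_eq_neq eq1 => ->; rewrite mod0n.
by rewrite inE => /andP[Xt /eqP <-]; apply/imset_f/(subsetP sXD).
Qed.

Lemma Aset_power {m D} : 0 < m -> coprime #|G| m -> is_Aset G S D ->
  is_Aset G S [set x ^+ m | x in D].
Proof.
elim/ltn_ind: m D => m IHm D m0 co_m AD; have [m_le1 | m_gt1] := leqP m 1.
  have -> : m = 1%N by apply/eqP; rewrite eqn_leq m_le1.
  by rewrite (eq_imset _ (fun x => expg1 x)) imset_id.
have p_pr := pdiv_prime m_gt1; have def_m := divnK (pdiv_dvd m).
rewrite -{}def_m in m0 m_gt1 co_m IHm *; set p := pdiv m in p_pr m0 m_gt1 co_m IHm *.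
set q := (m %/ p)%N in m0 m_gt1 co_m IHm *.
move: co_m; rewrite coprimeMr => /andP[co_q co_p].
have q0 : 0 < q by case: q m0 {m_gt1 co_q IHm}.
have -> : [set x ^+ (q * p) | x in D] = [set x ^+ p | x in [set x ^+ q | x in D]].
  by rewrite -imset_comp; apply: eq_imset => x /=; rewrite expgM.
by apply: Aset_prime_power => //; apply: IHm => //; rewrite ltn_Pmulr ?prime_gt1.
Qed.

(** A basic set [W] inside the image of [X] is carried by the inverse power map onto a set covering
    [X]; so [W] is at least as large as [X] and fills the image. *)
Lemma basic_power {m X} : 0 < m -> coprime #|G| m -> X \in S -> [set x ^+ m | x in X] \in S.
Proof.
move=> m0 co_m SX; have [x Xx] := basic_n0 SR SX.
have Gx := subsetP (basic_sub SR SX) x Xx.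
have AX := Aset_power m0 co_m (Aset_basic SR SX).
have [W SW Wx] := basic_cover SR (groupX m Gx).
have sWX := Aset_sub AX SW Wx (imset_f (fun x => x ^+ m) Xx).
suff -> : [set x ^+ m | x in X] = W by [].
apply/esym/eqP; rewrite eqEcard sWX /=; apply: leq_trans (leq_imset_card _ _) _.
(* By Euler's theorem [m ^ k] inverts [m] modulo [#|G|]. *)
pose k := (totient #|G|).-1.
have AW : is_Aset G S [set x ^+ (m ^ k) | x in W].
  by apply: Aset_power (Aset_basic SR SW); rewrite ?expn_gt0 ?m0 ?coprimeXr.
have: X \subset [set x ^+ (m ^ k) | x in W].
  apply: (Aset_sub AW SX Xx); apply/imsetP; exists (x ^+ m) => //.
  rewrite -expgM -expnS prednK ?totient_gt0 ?cardG_gt0 //.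
  rewrite -(expg_mod _ (expg_cardG Gx)) Euler_exp_totient 1?coprime_sym //.
  by rewrite (expg_mod _ (expg_cardG Gx)) expg1.
by move/subset_leq_card/leq_trans; apply; apply: leq_imset_card.
Qed.

End Multipliers.

(** * S-rings over cyclic groups without proper A-subgroups *)

Section CyclicSring.
Variables (gT : finGroupType) (G : {group gT}) (S : {set {set gT}}).
Hypotheses (SR : is_Sring G S) (cycG : cyclic G).
Implicit Types (X Y Z D W : {set gT}) (H E : {group gT}) (x y z : gT).

(** Among subgroups of a cyclic group, inclusion is divisibility of orders. *)
Lemma mem_cyclic_sub {H x} : H \subset G -> x \in G -> x ^+ #|H| = 1 -> x \in H.
Proof.
move=> sHG Gx x1; rewrite -cycle_subG -(cardSg_cyclic cycG) ?cycle_subG //.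
by rewrite -orderE order_dvdn x1.
Qed.

(** As [W] generates [G], it contains an element that is no [p]-th power, so the number of [p]-th
    roots of [y ^+ p] in [X] is divisible by [p]. These roots include [y] and lie in its coset
    modulo [E], which has [p] elements, so they fill it. *)
Lemma pth_power_coset {p E X W y} :
    prime p -> E \subset G -> #|E| = p -> X \in S -> W \in S -> <<W>> = G ->
  y \in X -> y ^+ p \in W -> forall e, e \in E -> e * y \in X.
Proof.
move=> p_pr sEG oE SX SW genW Xy Wyp e Ee; have cGG := cyclic_abelian cycG.
have sXG := basic_sub SR SX; have Gy := subsetP sXG y Xy.
have [w Ww not_pw] : exists2 w, w \in W & w \notin [set x ^+ p | x in G].
  apply/subsetPn/negP => /subsetP pW; have /cyclicP[g def_G] := cycG.
  have: G \subset <[g ^+ p]>.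
    rewrite -genW gen_subG; apply/subsetP=> w /pW/imsetP[x].
    by rewrite def_G => /cycleP[i ->] ->; rewrite -expgM mulnC expgM mem_cycle.
  move/subset_leq_card; rewrite -orderE orderXdiv; last first.
    by rewrite orderE -def_G -oE cardSg.
  by rewrite orderE -def_G leqNgt ltn_Pdiv ?prime_gt1.
have := schur_pth_power SR cGG p_pr SX SW Wyp Ww.
have -> : [set x in X | x ^+ p == w] = set0.
  apply/setP=> x; rewrite !inE; apply: contraNF not_pw => /andP[Xx /eqP <-].
  exact/imset_f/(subsetP sXG).
rewrite cards0 mod0n => /eqP; set F := [set _ | _] => pF.
have sFE : F \subset E :* y.
  apply/subsetP=> x; rewrite inE mem_rcoset => /andP[Xx /eqP xy].
  have Gx := subsetP sXG x Xx.
  apply: mem_cyclic_sub; rewrite ?groupM ?groupV //.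
  by rewrite oE expgMn ?expgVn ?xy ?mulgV //; apply: (centsP cGG); rewrite ?groupV.
have F0 : 0 < #|F| by apply/card_gt0P; exists y; rewrite inE Xy /=.
have /eqP defF : F == E :* y.
  by rewrite eqEcard sFE card_rcoset oE dvdn_leq.
have : e * y \in F by rewrite defF mem_rcoset mulgK.
by rewrite inE => /andP[].
Qed.

(** Schur's theorem by counting. If [#|G|] is not prime, a subgroup [E] of prime order is proper;
    outside [E] the basic sets are [E]-invariant, yet each one other than [[set 1]] meets [E]. This
    makes the coefficients of the product of [X] and [X^-1] too large for a small [X]. *)
Lemma primitive_prime : (forall H, is_Aset G S H -> H :=: 1 \/ H :=: G) ->
  2 < #|S| -> prime #|G|.
Proof.
move=> primS rkS; apply: contraT => npG.
(* Of two basic sets other than [[set 1]], the smaller has fewer than half of the elements of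
   [G]. *)
have [X SX ltXG]: exists2 X, X \in S :\ [set 1] & #|X|.*2 < #|G|.
  have: 1 < #|S :\ [set 1]| by rewrite (cardsD1 [set 1]) (basic1 SR) in rkS.
  case/card_gt1P=> X [Y [SX SY nXY]].
  have: #|X| + #|Y| < #|G|.
    move: SX SY; rewrite !inE => /andP[nX SX] /andP[nY SY].
    rewrite (card_basic SR) (bigD1 [set 1]) ?(basic1 SR) //= cards1 ltnS.
    rewrite (bigD1 X) ?SX //= leq_add2l (bigD1 Y) ?leq_addr //.
    by rewrite SY nY eq_sym.
  have [leXY | ltYX] := leqP #|X| #|Y| => ltG; [exists X | exists Y] => //.
    by rewrite -addnn (leq_ltn_trans _ ltG) // leq_add2l.
  by rewrite -addnn (leq_ltn_trans _ ltG) // leq_add2r ltnW.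
have [nX1 {}SX] : X != [set 1] /\ X \in S by move: SX; rewrite !inE => /andP[].
have G1 : 1 < #|G|.
  have [x Xx] := basic_n0 SR SX; have : 0 < #|X| by apply/card_gt0P; exists x.
  by rewrite -double_gt0 => X0; apply: leq_ltn_trans X0 ltXG.
pose p := pdiv #|G|; have p_pr : prime p by apply: pdiv_prime.
have [x0 Gx0 ox0] := Cauchy p_pr (pdiv_dvd #|G|).
pose E := <[x0]>%G; have oE : #|E| = p by rewrite -ox0.
have sEG : E \subset G by rewrite cycle_subG.
have nEG : ~ E :=: G by move=> EG; move: npG; rewrite -EG oE p_pr.
have genG Z : Z \in S -> Z != [set 1] -> <<Z>> = G.
  move=> SZ nZ1; have [|//] := primS <<Z>>%G (Aset_gen SR (Aset_basic SR SZ)).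
  have [z Zz] := basic_n0 SR SZ => gZ1; have := mem_gen Zz; rewrite /= in gZ1.
  by rewrite gZ1 inE => /eqP z1; move: (basic_not1 SR SZ nZ1); rewrite -z1 Zz.
(* For [y] outside [E], [y ^+ p] is not 1, so its basic set generates [G]. *)
have EX Z y e : Z \in S -> y \in Z -> y \notin E -> e \in E -> e * y \in Z.
  move=> SZ Zy nEy Ee; have Gy := subsetP (basic_sub SR SZ) y Zy.
  have [W SW Wyp] := basic_cover SR (groupX p Gy).
  apply: (pth_power_coset p_pr sEG oE SZ SW _ Zy Wyp Ee); apply: genG => //.
  apply: contraNneq nEy => W1; rewrite W1 inE in Wyp.
  by apply: mem_cyclic_sub => //; rewrite oE; apply/eqP.
(* A basic set missing [E] would have [E] in its radical; the radical, an A-subgroup, would be [G],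
   and the set would contain 1. *)
have meetE Z : Z \in S -> Z != [set 1] -> exists2 z, z \in Z & z \in E.
  move=> SZ nZ1; apply/exists_inP; apply: contraT.
  rewrite negb_exists_in => /forall_inP nZE.
  have sER : E \subset radical G Z.
    by apply: sub_radical => // h x Eh Zx; apply: EX (nZE _ _) _.
  have [R1 | RG] := primS _ (Aset_radical SR SZ).
    have := prime_gt1 p_pr; rewrite -oE cardG_gt1.
    by rewrite -subG1 (subset_trans sER) ?R1.
  have [z Zz] := basic_n0 SR SZ; have Gz := subsetP (basic_sub SR SZ) z Zz.
  have /radical_lcoset defZ : G \subset radical G Z by rewrite RG.
  have := basic_not1 SR SZ nZ1; rewrite -defZ.
  by rewrite -(mulVg z) mem_mulg ?groupV.
(* [c z] is the coefficient of [z] in X X^-1. It is at least |X \ E| on E, hence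
   on all of G^# since every basic set meets E; summing over G contradicts
   2|X| < |G|. *)
pose c z := #|X :&: z *: X|.
have le_c z : z \in G^# -> #|X :\: E| <= c z.
  case/setD1P=> nz1 Gz; have [Z SZ Zz] := basic_cover SR Gz.
  have [|e Ze Ee] := meetE Z SZ; first by apply: contraNneq nz1 => Z1; rewrite Z1 inE in Zz.
  rewrite /c (card_lcoset_cap SR SX SZ Zz Ze); apply: subset_leq_card.
  apply/subsetP=> x; rewrite !inE => /andP[nEx Xx]; rewrite Xx mem_lcoset /=.
  by apply: EX; rewrite ?groupV.
have sum_c : \sum_(z in G) c z = (#|X| * #|X|)%N.
  rewrite -sum_nat_const -(eq_bigr _ (fun z _ => sum1_card _)).
  under eq_bigr do rewrite (eq_bigl _ _ (fun x => in_setI x _ _)) big_mkcondr.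
  rewrite exchange_big; apply: eq_bigr => x Xx /=; rewrite -big_mkcondr /= sum1_card.
  have Gx := subsetP (basic_sub SR SX) x Xx.
  have inj_f : injective (fun y => x * y^-1) by move=> y z /mulgI/invg_inj.
  rewrite -(card_imset X inj_f).
  apply: eq_card => z; rewrite unfold_in mem_lcoset /=; apply/andP/imsetP=> [[Gz Xzx]|[y Xy ->]].
    by exists (z^-1 * x); rewrite // invMg invgK mulKVg.
  have Gy := subsetP (basic_sub SR SX) y Xy.
  by rewrite invMg invgK mulgKV groupM ?groupV.
have c1 : c 1 = #|X| by rewrite /c lcoset1 setIid.
have lesum : #|X| + #|G^#| * #|X :\: E| <= #|X| * #|X|.
  rewrite -sum_c (bigD1 1) //= c1 leq_add2l -sum_nat_const.
  rewrite [X in _ <= X](eq_bigl (mem G^#)) => [|z]; last by rewrite !inE andbC.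
  exact: leq_sum.
have [y Xy nEy] : exists2 y, y \in X & y \notin E.
  apply/subsetPn/negP => sXE; apply: nEG; apply/eqP; rewrite eqEsubset sEG.
  by rewrite -(genG X SX nX1) gen_subG.
(* [X :\: E] contains a whole [E]-coset, whereas [X :&: E] misses 1, so [p] separates their
   cardinals. *)
have le_pX1 : p <= #|X :\: E|.
  rewrite -oE -(card_rcoset E y); apply: subset_leq_card.
  apply/subsetP=> _ /rcosetP[e Ee ->]; rewrite inE groupMl // nEy /=.
  exact: EX.
have lt_X0p : #|X :&: E| < p.
  rewrite -oE; apply: proper_card; rewrite properE subsetIr /=.
  by apply/subsetPn; exists 1; rewrite // inE negb_and (basic_not1 SR SX).
have cX := cardsID E X; have X0 : 0 < #|X| by apply/card_gt0P; exists y.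
have leG : #|X|.*2 <= #|G^#| by move: ltXG; rewrite (cardsD1 1 G) group1.
(* Dividing by [#|X|] gives [#|X :\: E| < #|X :&: E|], against the two bounds by [p]. *)
have : #|X| * (1 + #|X :\: E|.*2) <= #|X| * #|X|.
  apply: leq_trans lesum; rewrite mulnDr muln1 leq_add2l -doubleMr doubleMl.
  by rewrite leq_mul2r leG orbT.
rewrite leq_pmul2l // -cX -addnn addnA leq_add2r add1n.
by move/ltn_trans/(_ (leq_trans lt_X0p le_pX1)); rewrite ltnn.
Qed.

End CyclicSring.

(** * S-rings over groups of prime order *)

Lemma power_Aut (gT : finGroupType) (G : {group gT}) (m : nat) :
  cyclic G -> coprime #|G| m -> exists2 a, a \in Aut G & {in G, forall x, a x = x ^+ m}.
Proof.
case/cyclicP=> g defG co_m; have co_g : coprime #|<[g]>| m by rewrite -defG.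
have inj_m : 'injm (cyclem m g).
  apply/injmP; apply: can_in_inj (fun x => x ^+ expg_invn <[g]> m) _ => x gx.
  exact: (expgK co_g gx).
have im_m : cyclem m g @* <[g]> = <[g]>.
  apply/morphim_fixP=> //; apply/subsetP=> _ /morphimP[x _ gx ->].
  exact: groupX.
exists (aut inj_m im_m) => [|x]; first by rewrite defG Aut_aut.
by rewrite defG; apply: autE.
Qed.

Section PrimeOrder.
Variables (gT : finGroupType) (G : {group gT}) (S : {set {set gT}}).
Hypotheses (SR : is_Sring G S) (pG : prime #|G|).
Implicit Types (X Y Z : {set gT}) (x y z : gT).

Lemma prime_power_eq {x y} : x \in G^# -> y \in G^# ->
  exists m, [/\ 0 < m, coprime #|G| m & y = x ^+ m].
Proof.
case/setD1P=> ntx Gx /setD1P[nty Gy].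
have gx : <[x]> = G.
  apply/eqP; rewrite eqEcard cycle_subG Gx /= -orderE.
  have /primeP[_ /(_ _ (order_dvdG Gx))/orP[|/eqP->//]] := pG.
  by rewrite order_eq1 (negPf ntx).
have /cycleP[m y_m] : y \in <[x]> by rewrite gx.
exists m; split=> //; first by case: m y_m nty => // ->; rewrite eqxx.
rewrite prime_coprime //; apply: contra nty => /dvdnP[k m_k].
by rewrite y_m m_k mulnC expgM expg_cardG // expg1n.
Qed.

(** [K] consists of the automorphisms fixing every basic set. Two elements of a basic set [X] other
    than [[set 1]] are related by a power map, which then fixes [X]. It fixes any other basic set
    too, because that is an image of [X] under a further power map and power maps commute. *)
Lemma prime_Sring_cyclotomic : exists K : {group {perm gT}},
  [/\ K \subset Aut G, (#|S|.-1 * #|K|)%N = #|G|.-1 & S = orbit 'P K @: G].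
Proof.
have cycG : cyclic G by apply: prime_cyclic.
have cGG : abelian G by apply: cyclic_abelian.
pose K := 'C_(Aut G)(S | 'P^*)%G; have sKA : K \subset Aut G by apply: subsetIl.
have K1 a : a \in K -> a 1 = 1.
  move/(subsetP sKA) => Aa; exact: (morph1 (autm_morphism Aa)).
have orbX X x : X \in S -> x \in X -> orbit 'P K x = X.
  move=> SX Xx; have Gx := subsetP (basic_sub SR SX) x Xx.
  have [x1 | ntx] := eqVneq x 1.
    rewrite x1 in Xx *; rewrite (basic_eq SR SX (basic1 SR) Xx (set11 1)).
    apply/setP=> y; rewrite inE; apply/orbitP/eqP=> [[a Ka <-]|->].
      exact: K1.
    by exists 1; [apply: group1 | apply: perm1].
  have nt Y y : Y \in S -> y \in Y -> y != 1 -> y \in G^#.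
    by move=> SY Yy nty; rewrite !inE nty (subsetP (basic_sub SR SY)).
  apply/setP=> y; apply/orbitP/idP=> [[a /setIP[_ /astabP/(_ X SX) aX] <-]|Xy].
    by rewrite -aX; apply: mem_setact.
  have nty : y != 1.
    by apply: contraNneq ntx => y1; rewrite -in_set1 (basic_eq SR (basic1 SR) SX (set11 1)) // -y1.
  have [m [m0 co_m y_m]] := prime_power_eq (nt X x SX Xx ntx) (nt X y SX Xy nty).
  have [a Aa aE] := power_Aut cycG co_m; exists a; last by rewrite y_m -aE.
  have powX k Y : 0 < k -> coprime #|G| k -> x ^+ k \in Y -> Y \in S -> [set t ^+ k | t in X] = Y.
    move=> k0 co_k Yx SY; have SXk := basic_power SR cGG k0 co_k SX.
    exact: (basic_eq SR SXk SY (imset_f (fun t => t ^+ k) Xx) Yx).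
  rewrite inE Aa; apply/astabP=> Z SZ; have [z Zz] := basic_n0 SR SZ.
  have -> : 'P^*%act Z a = [set t ^+ m | t in Z].
    apply: eq_in_imset => t Zt.
    by rewrite -aE // (subsetP (basic_sub SR SZ)).
  have [z1 | ntz] := eqVneq z 1.
    rewrite z1 in Zz; rewrite -(basic_eq SR (basic1 SR) SZ (set11 1) Zz).
    by rewrite imset_set1 expg1n.
  have [k [k0 co_k z_k]] := prime_power_eq (nt X x SX Xx ntx) (nt Z z SZ Zz ntz).
  have <- : [set t ^+ k | t in X] = Z by apply: powX; rewrite -?z_k.
  rewrite -imset_comp -{2}(powX m X) -?y_m // -imset_comp.
  by apply: eq_imset => t /=; rewrite -!expgM mulnC.
have defS : S = orbit 'P K @: G.
  apply/setP=> X; apply/idP/imsetP=> [SX | [x Gx ->]].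
    have [x Xx] := basic_n0 SR SX.
    by exists x; rewrite ?(orbX X x) // (subsetP (basic_sub SR SX)).
  by have [X' SX' X'x] := basic_cover SR Gx; rewrite (orbX X').
exists K; split=> //.
(* An automorphism fixing some [x] other than 1 fixes its powers, hence all of [G], so [K] acts
   freely on [G^#]. *)
have cardX X : X \in S -> X != [set 1] -> #|X| = #|K|.
  move=> SX nX1; have [x Xx] := basic_n0 SR SX; rewrite -(orbX X x SX Xx).
  have Gx := subsetP (basic_sub SR SX) x Xx.
  have ntx : x != 1 by apply: contraNneq (basic_not1 SR SX nX1) => <-.
  have <- := card_orbit_stab 'P K x; rewrite (_ : 'C_K[x | _] = 1) ?cards1 ?muln1 //.
  apply/trivgP/subsetP=> a /setIP[Ka /astab1P ax]; rewrite inE.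
  have Aa := subsetP sKA a Ka; apply/eqP/(eq_Aut Aa (group1 _)) => y Gy.
  rewrite perm1; have [-> | nty] := eqVneq y 1; first exact: K1.
  have [||m [_ _ ->]] := @prime_power_eq x y; rewrite ?inE ?ntx ?nty //.
  apply: etrans (morphX (autm_morphism Aa) m Gx) _; congr (_ ^+ m); exact: ax.
rewrite [in RHS](card_basic SR) (bigD1 [set 1]) ?(basic1 SR) //= cards1 add1n /=.
rewrite (eq_bigr (fun=> #|K|)) => [|X /andP[SX nX1]]; last exact: cardX.
rewrite (cardsD1 [set 1]) (basic1 SR) /= -sum_nat_const; apply: eq_bigl => X.
by rewrite !inE andbC.
Qed.

End PrimeOrder.

(** * Restrictions and quotients *)

Section SubSring.
Variables (gT : finGroupType) (G H : {group gT}) (S : {set {set gT}}).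
Hypotheses (SR : is_Sring G S) (AH : is_Aset G S H).

Lemma sub_Sring : is_Sring H (basic_in S H).
Proof.
have [prS S1 SV SM] := SR; have /and3P[_ tS S0] := prS; split.
- apply/and3P; split; last by rewrite inE (negPf S0).
    by apply/eqP/esym/(Asubgroup_Aset SR).
  by apply: trivIsetS tS; apply/subsetP=> X; rewrite inE => /andP[].
- by rewrite inE S1 sub1G.
- by move=> X; rewrite !inE => /andP[SX sXH]; rewrite SV // -invSg invgK invGid.
move=> X Y Z; rewrite !inE => /andP[SX _] /andP[SY _] /andP[SZ _].
exact: SM.
Qed.

(** Brings A-subgroups of the restriction back to [S], where the list of A-subgroups is
    available. *)
Lemma sub_Aset (D : {set gT}) : is_Aset H (basic_in S H) D -> is_Aset G S D.
Proof.
case=> sDH hD; split=> [|X x y SX Xx Xy Dx]; first exact: subset_trans sDH AH.1.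
apply: (hD X x y) => //; rewrite inE SX.
exact: (Aset_sub AH SX Xx (subsetP sDH x Dx)).
Qed.

End SubSring.

Lemma card_cosetpre_set (gT : finGroupType) (L : {group gT}) (Q : {set coset_of L}) :
  #|coset L @*^-1 Q| = (#|L| * #|Q|)%N.
Proof.
have Qc x : x \in coset L @*^-1 Q -> coset L x \in Q by case/morphpreP.
rewrite -sum1_card (partition_big (coset L) (mem Q)) //= mulnC -sum_nat_const.
apply: eq_bigr => u; case: (cosetP u) => y Ny -> Qy; rewrite sum1dep_card.
rewrite -(card_rcoset L y); apply: eq_card => x; rewrite inE; apply/andP/idP=> [[]|Lyx].
  by case/morphpreP=> Nx _ /eqP eq_xy; apply/rcoset_kercosetP.
have Nx : x \in 'N(L).
  by case/rcosetP: Lyx => h Lh ->; rewrite groupM // (subsetP (normG L)).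
have eq_xy : coset L x = coset L y by apply/rcoset_kercosetP.
by rewrite eq_xy; split=> //; apply/morphpreP; rewrite /= eq_xy.
Qed.

(** * Quotients under the wreath condition *)

Section QuotientSring.
Variables (gT : finGroupType) (G L : {group gT}) (S : {set {set gT}}).
Hypotheses (SR : is_Sring G S) (AL : is_Aset G S L) (nLG : L <| G).
Hypothesis wrL : wreath_cond S L.
Implicit Types (X Y Z : {set gT}) (x y z : gT).
Local Notation nL := (normal_norm nLG).

Lemma basic_in_top : basic_in S G = S.
Proof. by apply/setP=> X; rewrite inE andb_idr // => /(basic_sub SR). Qed.

Lemma coset_basic_sub X : X \in S -> X \subset L -> coset L @: X = [set 1].
Proof.
move=> SX sXL; have [x Xx] := basic_n0 SR SX; apply/setP=> u; rewrite inE.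
apply/imsetP/eqP=> [[y Xy ->]|->]; first by rewrite coset_id ?(subsetP sXL).
by exists x; rewrite // coset_id ?(subsetP sXL).
Qed.

Lemma mem_coset_basic X x : X \in S -> ~~ (X \subset L) -> x \in 'N(L) ->
  (coset L x \in coset L @: X) = (x \in X).
Proof.
move=> SX nXL Nx; apply/imsetP/idP=> [[y Xy eq_xy]|Xx]; last by exists x.
have Ny := subsetP (subset_trans (basic_sub SR SX) nL) y Xy.
rewrite -(wrL SX nXL).1; have: x \in L :* y by apply/rcoset_kercosetP.
by case/rcosetP=> h Lh ->; apply: mem_mulg.
Qed.

Lemma coset_basic_pre X : X \in S -> ~~ (X \subset L) -> coset L @*^-1 (coset L @: X) = X.
Proof.
move=> SX nXL; apply/setP=> x; apply/morphpreP/idP=> [[Nx]|Xx].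
  by rewrite /= mem_coset_basic.
have Nx : x \in 'N(L) by apply: (subsetP (subset_trans (basic_sub SR SX) nL)).
by rewrite /= mem_coset_basic.
Qed.

Lemma coset_basic_neq1 X : X \in S -> ~~ (X \subset L) -> coset L @: X != [set 1].
Proof.
move=> SX nXL; apply: contraNneq nXL => X1.
apply/subsetP=> x Xx; apply: coset_idr.
  exact: (subsetP (subset_trans (basic_sub SR SX) nL)).
by apply/eqP; rewrite -in_set1 -X1 imset_f.
Qed.

(** Makes the images of basic sets equal or disjoint: those inside [L] collapse to the identity, and
    a coset outside [L] lies in a single basic set. *)
Lemma coset_basic_memE {X Y x y} : X \in S -> Y \in S -> x \in X -> y \in Y ->
  coset L x = coset L y -> coset L @: X = coset L @: Y.
Proof.
move=> SX SY Xx Yy eq_xy.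
have Nx : x \in 'N(L) by apply: (subsetP (subset_trans (basic_sub SR SX) nL)).
have Ny : y \in 'N(L) by apply: (subsetP (subset_trans (basic_sub SR SY) nL)).
have [sXL | nXL] := boolP (X \subset L); last first.
  suff Xy : y \in X by rewrite (basic_eq SR SX SY Xy Yy).
  by rewrite -(mem_coset_basic SX nXL Ny) -eq_xy imset_f.
have Ly : y \in L by apply: coset_idr; rewrite -?eq_xy // coset_id ?(subsetP sXL).
by rewrite !coset_basic_sub // (Aset_sub AL SY Yy Ly).
Qed.

(** A factorisation of [coset L z] lifts in [#|L|] ways: the first factor is any element of its
    coset, and the second, then determined, lies in [Y], a union of [L]-cosets. *)
Lemma coset_count X Y z : X \in S -> Y \in S -> ~~ (X \subset L) -> ~~ (Y \subset L) ->
    z \in G ->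
  (#|L| * #|[set xy in setX (coset L @: X) (coset L @: Y) | xy.1 * xy.2 == coset L z]%g|)%N =
  #|[set xy in setX X Y | xy.1 * xy.2 == z]|.
Proof.
move=> SX SY nXL nYL Gz; rewrite !card_mul_fiber -card_cosetpre_set.
apply: eq_card => x; have Nz := subsetP nL z Gz.
have memY t : t \in 'N(L) -> ((coset L t)^-1 * coset L z \in coset L @: Y) = (t^-1 * z \in Y).
  move=> Nt; rewrite -(mem_coset_basic SY nYL) ?groupM ?groupV //.
  by rewrite morphM ?morphV ?groupV.
apply/morphpreP/setIdP=> [[Nx /setIdP[]]|[Xx Yxz]].
  by rewrite mem_coset_basic ?memY.
have Nx : x \in 'N(L) by apply: (subsetP (subset_trans (basic_sub SR SX) nL)).
by split=> //; apply/setIdP; rewrite mem_coset_basic ?memY.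
Qed.

Lemma quotient_Sring : is_Sring (G / L) (basic_quo S L G).
Proof.
have sXN X : X \in S -> X \subset 'N(L) by move/(basic_sub SR)/subset_trans; apply; exact: nL.
have quoE (X : {set gT}) : X \subset 'N(L) -> coset L @: X = X / L.
  by move=> sXN'; rewrite quotientE morphimEsub.
have blockE U V u : U \in basic_quo S L G -> V \in basic_quo S L G -> u \in U -> u \in V -> U = V.
  rewrite /basic_quo basic_in_top => /imsetP[X SX ->] /imsetP[Y SY ->] /imsetP[x Xx ->].
  case/imsetP=> y Yy; exact: coset_basic_memE.
have block1 : [set 1] \in basic_quo S L G.
  rewrite /basic_quo basic_in_top; apply/imsetP; exists [set 1]; first exact: basic1 SR.
  by rewrite coset_basic_sub ?(basic1 SR) ?sub1G.
split=> //.
- apply/and3P; split.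
  + apply/eqP/setP=> u; apply/bigcupP/idP=> [[U]|/imsetP[x]].
      rewrite /basic_quo basic_in_top => /imsetP[X SX ->]; rewrite quoE ?sXN //.
      exact/subsetP/quotientS/(basic_sub SR).
    rewrite inE => /andP[Nx Gx] ->; have [X SX Xx] := basic_cover SR Gx.
    exists (coset L @: X); last exact: imset_f.
    by rewrite /basic_quo basic_in_top imset_f.
  + apply/trivIsetP=> U V QU QV; apply: contraNT => /pred0Pn[u /= /andP[Uu Vu]].
    by rewrite (blockE U V u).
  + rewrite /basic_quo basic_in_top; apply/imsetP=> -[X SX] /setP X0.
    have [x Xx] := basic_n0 SR SX; have := X0 (coset L x).
    by rewrite inE imset_f.
- move=> U; rewrite /basic_quo basic_in_top => /imsetP[X SX ->]; apply/imsetP.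
  by exists X^-1; rewrite ?(basicV SR) // !quoE ?sXN ?(basicV SR) // quotientV.
move=> U V W QU QV QW w1 w2 Ww1 Ww2.
have memW T : T \in basic_quo S L G -> (w1 \in T) = (w2 \in T).
  move=> QT; apply/idP/idP=> Tw.
    by rewrite -(blockE W T w1).
  by rewrite -(blockE W T w2).
rewrite !card_mul_fiber.
(* The block [[set 1]] comes from basic sets inside [L], to which [coset_count] does not apply;
   products with it are counted directly. *)
have [U1 | ntU] := eqVneq U [set 1].
  have cU w : #|[set x in U | x^-1 * w \in V]| = (w \in V).
    rewrite U1; case Vw: (w \in V).
      apply: etrans (cards1 (1 : coset_of L)); apply: eq_card => x; rewrite !inE.
      by case: eqP => //= ->; rewrite invg1 mul1g.
    apply/eqP; rewrite cards_eq0; apply/eqP/setP=> x; rewrite !inE.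
    by case: eqP => //= ->; rewrite invg1 mul1g.
  by rewrite !cU memW.
have [V1 | ntV] := eqVneq V [set 1].
  have cV w : #|[set x in U | x^-1 * w \in V]| = (w \in U).
    rewrite V1; case Uw: (w \in U).
      apply: etrans (cards1 w); apply: eq_card => x; rewrite !inE.
      rewrite -eq_mulVg1; case: eqP => [->|]; by rewrite ?andbF ?andbT.
    apply/eqP; rewrite cards_eq0; apply/eqP/setP=> x; rewrite !inE -eq_mulVg1.
    by case: eqP => [->|]; rewrite ?Uw ?andbF.
  by rewrite !cV memW.
move: QU QV QW ntU ntV Ww1 Ww2; rewrite -!card_mul_fiber /basic_quo basic_in_top.
case/imsetP=> X SX -> /imsetP[Y SY ->] /imsetP[Z SZ ->] ntX ntY.
have nXL : ~~ (X \subset L) by apply: contraNN ntX => sXL; rewrite coset_basic_sub.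
have nYL : ~~ (Y \subset L) by apply: contraNN ntY => sYL; rewrite coset_basic_sub.
case/imsetP=> z1 Zz1 -> /imsetP[z2 Zz2 ->]; apply/eqP.
have sZG := subsetP (basic_sub SR SZ).
rewrite -(eqn_pmul2l (cardG_gt0 L)) !coset_count ?sZG //; apply/eqP.
by case: SR => _ _ _ /(_ X Y Z SX SY SZ z1 z2 Zz1 Zz2).
Qed.

Lemma quotient_Aset_pre (Q : {set coset_of L}) :
  is_Aset (G / L) (basic_quo S L G) Q -> is_Aset G S (coset L @*^-1 Q).
Proof.
case=> sQ hQ; split=> [|X x y SX Xx Xy].
  by apply: subset_trans (morphpreS _ sQ) _; rewrite quotientGK.
have Ny : y \in 'N(L) by apply: (subsetP (subset_trans (basic_sub SR SX) nL)).
case/morphpreP=> Nx Qx; apply/morphpreP; split=> //.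
apply: (hQ (coset L @: X) (coset L x)); rewrite ?imset_f //.
by rewrite basic_in_top.
Qed.

End QuotientSring.

(** * Outer basic sets with trivial radical *)

Section TrivialRadical.
Variables (gT : finGroupType) (G L : {group gT}) (S : {set {set gT}}) (Y Z : {set gT}).
Hypotheses (SR : is_Sring G S) (cycG : cyclic G) (rkS : #|S| = 4).
Hypotheses (AL : is_Aset G S L) (ntL : 1 < #|L|).
Hypothesis uniqL : forall H : {group gT}, is_Aset G S H -> [\/ H :=: 1, H :=: L | H :=: G].
Hypothesis defS : S = [set [set 1]; L^#; Y; Z].
Hypotheses (nYL : ~~ (Y \subset L)) (nYZ : Y != Z).
Hypothesis radY : ~~ (L \subset radical G Y).
Implicit Types (x y z e : gT).

Let cGG := cyclic_abelian cycG.
Let SL : L^# \in S. Proof. by rewrite defS !inE eqxx ?orbT. Qed.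
Let SY : Y \in S. Proof. by rewrite defS !inE eqxx ?orbT. Qed.
Let SZ : Z \in S. Proof. by rewrite defS !inE eqxx ?orbT. Qed.
Let sLG : L \subset G. Proof. by case: AL. Qed.
Let inG X x : X \in S -> x \in X -> x \in G.
Proof. by move=> SX; apply/subsetP/(basic_sub SR SX). Qed.

Let mulgGC : {in G &, commutative mulg}.
Proof. by move=> x y Gx Gy; apply: (centsP cGG). Qed.

Let YL y : y \in Y -> y \notin L.
Proof. by move=> Yy; apply: contraNN nYL => /(Aset_sub AL SY Yy). Qed.

Let YZ_out x : x \in G -> x \notin L -> (x \in Y) || (x \in Z).
Proof.
move=> Gx nLx; have [X SX Xx] := basic_cover SR Gx.
move: SX Xx; rewrite defS !inE -!orbA => /or4P[] /eqP->; last 2 first.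
- by move->.
- by move->; rewrite orbT.
- by rewrite inE => /eqP x1; rewrite x1 group1 in nLx.
by rewrite inE (negPf nLx) andbF.
Qed.

Let gen_out X : X \in S -> ~~ (X \subset L) -> <<X>> = G.
Proof.
move=> SX nXL; have [||//] := uniqL (Aset_gen SR (Aset_basic SR SX)) => /= gX.
  by case/negP: nXL; rewrite (subset_trans (subset_gen X)) // gX sub1G.
by case/negP: nXL; rewrite -gX subset_gen.
Qed.

(** The radical of [Y] is an A-subgroup not containing [L], hence trivial. *)
Let sub_rad (E : {group gT}) : 1 < #|E| -> E \subset G ->
  exists2 y, y \in Y & exists2 e, e \in E & e * y \notin Y.
Proof.
move=> ntE sEG; have /subsetPn[e Ee] : ~~ (E \subset radical G Y).
  apply: contraNN radY => sER; have [R1|->//|RG] := uniqL (Aset_radical SR SY).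
    by move: ntE; rewrite cardG_gt1 -subG1 (subset_trans sER) // R1.
  by rewrite RG.
rewrite inE (subsetP sEG) //= eqEcard card_lcoset leqnn andbT.
by case/subsetPn=> _ /lcosetP[y Yy ->] nYey; exists y => //; exists e.
Qed.

Section Prime.
Variables (p : nat) (E : {group gT}).
Hypotheses (p_pr : prime p) (oE : #|E| = p) (sEL : E \subset L).
Let sEG := subset_trans sEL sLG.

Lemma outer_shift y e : y \in Y -> y ^+ p \notin L -> e \in E -> e * y \in Y.
Proof.
move=> Yy nLyp Ee; have [W SW Wyp] := basic_cover SR (groupX p (inG SY Yy)).
apply: (pth_power_coset SR cycG p_pr sEG oE SY SW _ Yy Wyp Ee).
by apply: gen_out => //; apply: contraNN nLyp => /subsetP->.
Qed.

Let p_dv_L : p %| #|L|. Proof. by rewrite -oE cardSg. Qed.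

Let mem_E x : x \in G -> x ^+ p = 1 -> x \in E.
Proof. by rewrite -oE; apply: mem_cyclic_sub. Qed.

(** The [m]-th power map multiplies [y] by an element [c] of order [p] and fixes [E] pointwise. Its
    square preserves [Y] and multiplies [y] by [c ^+ 2], which generates [E] as [p] is odd. *)
Lemma odd_shift : odd p -> forall y e, y \in Y -> y ^+ p \in L -> e \in E -> e * y \in Y.
Proof.
move=> odd_p y e Yy Lyp Ee; have Gy := inG SY Yy.
(* [lt] is divisible by [p] and by the part [t] of [#|G|] prime to [p], so [m] is coprime to [#|G|];
   the factor [#|L|] makes [c ^+ p] trivial below. *)
pose t := (#|G|`_p^')%N; pose lt := (#|L| * t)%N; pose m := (1 + lt)%N.
have p_dv_lt : p %| lt by rewrite dvdn_mulr.
have co_pt : coprime p t by rewrite (pnat_coprime (pnat_id p_pr)) ?part_pnat.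
have co_m : coprime #|G| m.
  have co_mul d k : d %| k -> coprime d (1 + k).
    by case/dvdnP=> a ->; rewrite -coprime_modr addnC modnMDl coprime_modr coprimen1.
  rewrite -(partnC p (cardG_gt0 G)) coprimeMl p_part coprimeXl ?co_mul //.
  by rewrite dvdn_mull.
have m_gt0 : 0 < m by [].
have expm_inj : {in G &, injective (fun x : gT => x ^+ m)}.
  by move=> a b Ga Gb /= eq_ab; rewrite -(expgK co_m Ga) /= eq_ab (expgK co_m Gb).
have pow_out x : x \in G -> x \notin L -> x ^+ m \notin L.
  move=> Gx; apply: contraNN => Lxm.
  by rewrite -(expgK co_m Gx) groupX.
(* The m-th power map is injective and permutes {Y, Z}. *)
have YY x : x \in Y -> (x ^+ m) ^+ m \in Y.
  move=> Yx; have Gx := inG SY Yx; have nLx := YL Yx.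
  have powm X a : X \in S -> a \in X ->
      [set b ^+ m | b in X] \in S /\ a ^+ m \in [set b ^+ m | b in X].
    move=> SX Xa; rewrite (basic_power SR cGG m_gt0 co_m SX).
    by rewrite (imset_f (fun b => b ^+ m)).
  have [SYm Yxm] := powm _ _ SY Yx.
  have Gxm := groupX m Gx; have nLxm := pow_out _ Gx nLx.
  case/orP: (YZ_out Gxm nLxm) => [Y'xm | Z'xm].
    rewrite -(basic_eq SR SYm SY Yxm Y'xm); exact: (imset_f (fun b => b ^+ m)).
  case/orP: (YZ_out (groupX m Gxm) (pow_out _ Gxm nLxm)) => // Zxmm.
  have YmZ := basic_eq SR SYm SZ Yxm Z'xm.
  have [SZm Zxmm'] := powm _ _ SZ Z'xm; have ZmZ := basic_eq SR SZm SZ Zxmm' Zxmm.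
  case/negP: nYZ; apply/eqP; apply: (basic_eq SR SY SZ Yx).
  have : x ^+ m \in [set b ^+ m | b in Z] by rewrite ZmZ.
  by case/imsetP=> b Zb /expm_inj-> //; apply: inG Zb.
pose c := y ^+ lt; pose d := c ^+ 2.
have ypl : y ^+ (p * #|L|) = 1 by rewrite expgM expg_cardG.
have cp : c ^+ p = 1 by rewrite -expgM mulnC mulnA expgM ypl expg1n.
have Gc : c \in G by apply: groupX.
(* If [c] were 1, the order of [y ^+ #|L|] would divide both [p] and [t], so this power would be 1
   and [y] would lie in [L]. *)
have c1 : c != 1.
  apply: contraNneq (YL Yy) => c1; apply: (mem_cyclic_sub cycG) => //.
  apply/eqP; rewrite -order_eq1 -dvdn1 -(eqP co_pt) dvdn_gcd !order_dvdn.
  by rewrite -!expgM mulnC ypl -/lt -/c c1 eqxx.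
have oc : #[c] = p by apply: nt_prime_order.
have d1 : d != 1.
  by rewrite -order_dvdn oc dvdn_prime2 //; apply: contraTneq odd_p => ->.
have dp : d ^+ p = 1 by rewrite -expgM mulnC expgM cp expg1n.
have Gd : d \in G by apply: groupX.
have dE : <[d]> = E.
  apply/eqP; rewrite eqEcard cycle_subG mem_E //=.
  by rewrite oE -orderE (nt_prime_order p_pr).
have dj j : y * d ^+ j \in Y.
  elim: j => [|j IHj]; first by rewrite mulg1.
  suff -> : y * d ^+ j.+1 = ((y * d ^+ j) ^+ m) ^+ m by apply: YY.
  have Gdj := groupX j Gd.
  have lt1 x : x ^+ p = 1 -> x ^+ m = x.
    move=> xp; case/dvdnP: p_dv_lt => k; rewrite /m expgD expg1 mulnC => ->.
    by rewrite expgM xp expg1n mulg1.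
  have djp : (d ^+ j) ^+ p = 1 by rewrite -expgM mulnC expgM dp expg1n.
  have ym : y ^+ m = y * c by rewrite expgD expg1.
  have cGdj : commute (y * c) (d ^+ j) by apply: mulgGC; rewrite ?groupM.
  have -> : (y * d ^+ j) ^+ m = y * c * d ^+ j.
    by rewrite expgMn ?ym ?(lt1 _ djp) //; apply: mulgGC.
  have -> : (y * c * d ^+ j) ^+ m = (y * c) ^+ m * d ^+ j.
    by rewrite [LHS]expgMn ?(lt1 _ djp).
  have -> : (y * c) ^+ m = y * c * c.
    by rewrite expgMn ?ym ?(lt1 _ cp) //; apply: mulgGC.
  by rewrite expgS /d -!mulgA.
have /cycleP[j ->] : e \in <[d]> by rewrite dE.
by rewrite mulgGC ?groupX.
Qed.

End Prime.

(** Start from [y0] in [Y] with a translate [e0 * y0] outside [Y]; the shift lemmas force [p = 2]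
    and [y0 ^+ 2] in [L]. Counting square roots modulo 2 gives [#|L| = 2], and translation by [e0]
    then reduces [Y] and [Z] to singletons. *)
Lemma trivial_radical_Z4 : #|G| = 4 /\ S = [set [set x] | x in G].
Proof.
pose p := pdiv #|L|; have p_pr : prime p by apply: pdiv_prime.
have [x0 Lx0 ox0] := Cauchy p_pr (pdiv_dvd #|L|).
pose E := <[x0]>%G; have oE : #|E| = p by rewrite -ox0.
have sEL : E \subset L by rewrite cycle_subG.
have sEG := subset_trans sEL sLG.
have [|y0 Yy0 [e0 Ee0 nYz0]] := sub_rad _ sEG; first by rewrite oE prime_gt1.
have Ly0p : y0 ^+ p \in L.
  by apply: contraNT nYz0 => nL; apply: (outer_shift p_pr oE sEL Yy0 nL Ee0).
have p2 : p = 2.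
  case: (even_prime p_pr) => // odd_p; case/negP: nYz0.
  exact: (odd_shift p_pr oE sEL odd_p Yy0 Ly0p Ee0).
rewrite p2 in oE Ly0p *.
have mem_E x : x \in G -> x ^+ 2 = 1 -> x \in E by rewrite -oE; apply: mem_cyclic_sub.
have Le0 := subsetP sEL e0 Ee0; have Ge0 := subsetP sLG e0 Le0.
have nte0 : e0 != 1 by apply: contraNneq nYz0 => ->; rewrite mul1g.
have e0e0 : e0 * e0 = 1 by have := expg_cardG Ee0; rewrite oE.
have defE : E = [set 1; e0] :> {set gT}.
  by apply/esym/eqP; rewrite eqEcard subUset !sub1set group1 Ee0 cards2 oE eq_sym nte0.
have Gy0 := inG SY Yy0.
(* The square roots of [y0 ^+ 2] in [G] are [y0] and [e0 * y0], and the latter is not in [Y]. *)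
have sqE x : x \in Y -> x ^+ 2 = y0 ^+ 2 -> x = y0.
  move=> Yx eq_xy; have Gx := inG SY Yx.
  have : x * y0^-1 \in E.
    apply: mem_E; first by rewrite groupM ?groupV.
    by rewrite expgMn ?expgVn ?eq_xy ?mulgV //; apply: mulgGC; rewrite ?groupV.
  rewrite defE !inE -eq_mulgV1 => /orP[/eqP//|/eqP xy].
  by case/negP: nYz0; rewrite -xy mulgKV.
have nt_sq x : x \in Y -> x ^+ 2 != 1.
  move=> Yx; apply: contraNneq (YL Yx) => x2.
  exact: (subsetP sEL _ (mem_E x (inG SY Yx) x2)).
(* [y0 ^+ 2] has exactly one square root in [Y], so every element of its basic set [L^#] has an odd
   number of them. *)
have sq_surj g : g \in L^# -> exists2 x, x \in Y & x ^+ 2 = g.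
  move=> Lg; have L1y0 : y0 ^+ 2 \in L^# by rewrite !inE nt_sq.
  have := schur_pth_power SR cGG (isT : prime 2) SY SL L1y0 Lg.
  have -> : [set x in Y | x ^+ 2 == y0 ^+ 2] = [set y0].
    by apply/setP=> x; rewrite !inE; apply/andP/eqP=> [[Yx /eqP/sqE->]|->].
  rewrite cards1 => eq1; have /card_gt0P[x] : 0 < #|[set x in Y | x ^+ 2 == g]|.
    by rewrite lt0n; apply: contra_eq_neq eq1 => ->.
  by rewrite inE => /andP[Yx /eqP]; exists x.
have oL : #|L| = 2.
  have /cyclicP[h defL] := cyclicS sLG cycG; have Lh : h \in L by rewrite defL cycle_id.
  have Gh := subsetP sLG h Lh.
  (* Otherwise [h ^+ 2] is the square of some [x] in [Y], and [x] lies in the [E]-coset of [h],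
     inside [L]. *)
  have h2 : h ^+ 2 = 1.
    apply/eqP/idPn => nth2; have [|x Yx eq_xh] := sq_surj (h ^+ 2).
      by rewrite !inE nth2 groupX.
    have Gx := inG SY Yx; case/negP: (YL Yx); rewrite -(mulgKV h x) groupM //.
    apply: (subsetP sEL); apply: mem_E; first by rewrite groupM ?groupV.
    by rewrite expgMn ?expgVn ?eq_xh ?mulgV //; apply: mulgGC; rewrite ?groupV.
  apply/eqP; rewrite eqn_leq ntL andbT defL -orderE.
  by apply: dvdn_leq => //; rewrite order_dvdn h2.
have defL : L :=: E by apply/esym/eqP; rewrite eqEcard sEL oE oL.
have L1 : L^# = [set e0].
  rewrite defL defE; apply/setP=> x; rewrite !inE.
  by case: (x =P 1) => //= ->; rewrite eq_sym (negPf nte0).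
have Se0 : [set e0] \in S by rewrite -L1.
(* If [e0 * y] left [Y], then [y ^+ 2], like [y0 ^+ 2], would be the only element [e0] of [L^#],
   whence [y = y0]. *)
have e0Y y : y \in Y -> y != y0 -> e0 * y \in Y.
  move=> Yy ny; apply: contraNT ny => nYey.
  have Ly2 : y ^+ 2 \in L.
    by apply: contraNT nYey => nL; apply: (outer_shift (isT : prime 2) oE sEL Yy nL Ee0).
  have /set1P y2 : y ^+ 2 \in [set e0] by rewrite -L1 !inE nt_sq.
  have /set1P y02 : y0 ^+ 2 \in [set e0] by rewrite -L1 !inE nt_sq.
  by apply/eqP/sqE; rewrite ?y2.
have Zz0 : e0 * y0 \in Z.
  have nLz0 : e0 * y0 \notin L by rewrite groupMl ?YL.
  by have := YZ_out (groupM Ge0 Gy0) nLz0; rewrite (negPf nYz0).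
have Ae0M X : X \in S -> is_Aset G S ([set e0] * X).
  by move=> SX; apply: AsetM => //; apply: (Aset_basic SR).
(* [[set e0] * Y] is a union of basic sets meeting [Z], hence contains [Z]; of its elements only
   [e0 * y0] lies outside [Y]. *)
have defZ : Z = [set e0 * y0].
  apply/eqP; rewrite eqEsubset sub1set Zz0 andbT; apply/subsetP=> z Zz.
  have /subsetP/(_ z Zz) : Z \subset [set e0] * Y.
    by apply: (Aset_sub (Ae0M _ SY) SZ Zz0); rewrite mem_mulg ?set11.
  case/mulsgP=> _ y /set1P-> Yy def_z; rewrite inE def_z.
  have [-> // | ny] := eqVneq y y0; have := e0Y y Yy ny; rewrite -def_z => Yz.
  by case/eqP: nYZ; apply: (basic_eq SR SY SZ Yz Zz).
have defY : Y = [set y0].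
  apply/eqP; rewrite eqEsubset sub1set Yy0 andbT.
  have /subset_trans : Y \subset [set e0] * Z.
    apply: (Aset_sub (Ae0M _ SZ) SY Yy0).
    by apply/mulsgP; exists e0 (e0 * y0); rewrite ?set11 // mulgA e0e0 mul1g.
  apply; rewrite defZ mulg_set1 mulgA e0e0 mul1g; exact: subxx.
have single X : X \in S -> exists x, X = [set x].
  rewrite defS L1 defY defZ !inE -!orbA => /or4P[] /eqP->; by eexists.
split.
  rewrite (card_basic SR) -rkS -sum1_card; apply: eq_bigr => X /single[x ->].
  by rewrite cards1.
apply/setP=> X; apply/idP/imsetP=> [SX|[x Gx ->]].
  by have [x defX] := single X SX; exists x => //; apply: (inG SX); rewrite defX set11.
have [X' SX'] := basic_cover SR Gx; have [x' defX'] := single X' SX'.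
by rewrite defX' => /set1P->; rewrite -defX'.
Qed.

End TrivialRadical.

(** * Rank four *)

Section RankFour.
Variables (gT : finGroupType) (G : {group gT}) (S : {set {set gT}}).
Hypotheses (SR : is_Sring G S) (cycG : cyclic G) (rkS : srank S = 4).
Implicit Types (H L U : {group gT}) (X Y Z D : {set gT}) (x y z : gT).

Let cGG := cyclic_abelian cycG.

(** Each of the three sets contains a basic set; with [[set 1]] these are four distinct ones, hence
    all of [S], and disjointness leaves no second basic set for any of the three. *)
Lemma Aset_partition4 D1 D2 D3 :
    is_Aset G S D1 -> is_Aset G S D2 -> is_Aset G S D3 ->
    D1 != set0 -> D2 != set0 -> D3 != set0 ->
    1 \notin D1 :|: D2 :|: D3 ->
    D1 :&: D2 = set0 -> D1 :&: D3 = set0 -> D2 :&: D3 = set0 ->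
  S = [set [set 1]; D1; D2; D3].
Proof.
move=> A1 A2 A3 n1 n2 n3; rewrite !inE !negb_or => /andP[/andP[D1'1 D2'1] D3'1] D12 D13 D23.
have pick_block D : is_Aset G S D -> D != set0 -> exists X, [/\ X \in S, X != set0 & X \subset D].
  move=> AD /set0Pn[x Dx]; have [X SX Xx] := basic_cover SR (subsetP AD.1 x Dx).
  by exists X; split; rewrite ?(Aset_sub AD SX Xx Dx) //; apply/set0Pn; exists x.
have [X1 [SX1 nX1 sX1]] := pick_block _ A1 n1.
have [X2 [SX2 nX2 sX2]] := pick_block _ A2 n2.
have [X3 [SX3 nX3 sX3]] := pick_block _ A3 n3.
have neq D D' X X' : D :&: D' = set0 -> X \subset D -> X' \subset D' -> X != set0 -> X != X'.
  move=> DD' sXD sXD' nX; apply: contraNneq nX => eqX; rewrite -subset0 -DD' subsetI sXD.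
  by rewrite eqX.
have not1 D X : 1 \notin D -> X \subset D -> [set 1] != X.
  by move=> nD1 sXD; apply: contraNneq nD1 => eqX; rewrite (subsetP sXD) // -eqX set11.
have defS : S = [set [set 1]; X1; X2; X3].
  apply/esym/eqP; rewrite eqEcard !subUset !sub1set (basic1 SR) SX1 SX2 SX3 /=.
  have -> : #|S| = 4 by exact: rkS.
  rewrite -!setUA !cardsU1 cards1 !inE !negb_or.
  by rewrite (not1 _ _ D1'1 sX1) (not1 _ _ D2'1 sX2) (not1 _ _ D3'1 sX3)
     (neq _ _ _ _ D12 sX1 sX2 nX1) (neq _ _ _ _ D13 sX1 sX3 nX1)
     (neq _ _ _ _ D23 sX2 sX3 nX2).
have full D X : is_Aset G S D -> X \in S -> X \subset D ->
    (forall X', X' \in S -> X' != X -> X' :&: D = set0) -> D = X.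
  move=> AD SX sXD hD; apply/eqP; rewrite eqEsubset sXD andbT; apply/subsetP=> x Dx.
  have [X' SX' X'x] := basic_cover SR (subsetP AD.1 x Dx).
  by have [<- // | /(hD _ SX')/setP/(_ x)] := eqVneq X' X; rewrite !inE X'x Dx.
have sub0 D D' X : D :&: D' = set0 -> X \subset D -> X :&: D' = set0.
  by move=> DD' sXD; apply/eqP; rewrite -subset0 -DD' setSI.
have one0 D : 1 \notin D -> [set 1] :&: D = set0.
  by move=> nD1; apply/setP=> x; rewrite !inE; case: eqP => //= ->; apply/negbTE.
have D21 : D2 :&: D1 = set0 by rewrite setIC.
have D31 : D3 :&: D1 = set0 by rewrite setIC.
have D32 : D3 :&: D2 = set0 by rewrite setIC.
have casesS X : X \in S -> [\/ X = [set 1], X = X1, X = X2 | X = X3].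
  by rewrite defS !inE -!orbA => /or4P[] /eqP->; [apply: Or41|apply: Or42|apply: Or43|apply: Or44].
have eq1 : D1 = X1.
  apply: full => // X' /casesS[]-> nX.
  - exact: one0.
  - by case/eqP: nX.
  - exact: sub0 D21 sX2.
  - exact: sub0 D31 sX3.
have eq2 : D2 = X2.
  apply: full => // X' /casesS[]-> nX.
  - exact: one0.
  - exact: sub0 D12 sX1.
  - by case/eqP: nX.
  - exact: sub0 D32 sX3.
have eq3 : D3 = X3.
  apply: full => // X' /casesS[]-> nX.
  - exact: one0.
  - exact: sub0 D13 sX1.
  - exact: sub0 D23 sX2.
  - by case/eqP: nX.
by rewrite eq1 eq2 eq3.
Qed.

Lemma chain_case L U : is_Aset G S L -> is_Aset G S U -> 1 < #|L| ->
  L \proper U -> U \proper G -> S = [set [set 1]; L^#; U :\: L; G :\: U].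
Proof.
move=> AL AU ntL pLU pUG.
have sLU := proper_sub pLU; have /properP[_ [u Uu nLu]] := pLU.
have /properP[_ [g Gg nUg]] := pUG.
apply: Aset_partition4.
- exact: AsetD AL (Aset_basic SR (basic1 SR)).
- exact: AsetD.
- exact: AsetD (AsetG SR) AU.
- by rewrite setD_eq0 subG1 -cardG_gt1.
- by apply/set0Pn; exists u; rewrite inE nLu.
- by apply/set0Pn; exists g; rewrite inE nUg.
- by rewrite !inE eqxx !group1.
- by apply/setP=> x; rewrite !inE; case: (x \in L); rewrite ?andbF.
- by apply/setP=> x; rewrite !inE; case Lx: (x \in L); rewrite ?andbF //= (subsetP sLU x Lx) andbF.
by apply/setP=> x; rewrite !inE; case: (x \in U); rewrite ?andbF.
Qed.

Lemma tensor_case L U : is_Aset G S L -> is_Aset G S U -> 1 < #|L| -> 1 < #|U| ->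
  L :&: U = 1 -> S = [set [set 1]; L^#; U^#; L^# * U^#].
Proof.
move=> AL AU ntL ntU tiLU.
have A1 := Aset_basic SR (basic1 SR).
have [x Lx ntx] : exists2 x, x \in L & x != 1 by apply/trivgPn; rewrite -cardG_gt1.
have [y Uy nty] : exists2 y, y \in U & y != 1 by apply/trivgPn; rewrite -cardG_gt1.
have inLU z : z \in L -> z \in U -> z = 1.
  by move=> Lz Uz; apply/set1P; rewrite -[[set 1]]/(1 : {set gT}) -tiLU inE Lz.
have notL z : z \in L^# * U^# -> z \notin L.
  case/mulsgP=> a b /setD1P[nta La] /setD1P[ntb Ub] ->; rewrite groupMl //.
  by apply: contraNN ntb => Lb; rewrite (inLU b).
have notU z : z \in L^# * U^# -> z \notin U.
  case/mulsgP=> a b /setD1P[nta La] /setD1P[ntb Ub] ->; rewrite groupMr //.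
  by apply: contraNN nta => Ua; rewrite (inLU a).
apply: Aset_partition4.
- exact: AsetD.
- exact: AsetD.
- by apply: AsetM => //; apply: AsetD.
- by apply/set0Pn; exists x; rewrite !inE ntx.
- by apply/set0Pn; exists y; rewrite !inE nty.
- by apply/set0Pn; exists (x * y); rewrite mem_mulg // !inE ?ntx ?nty.
- rewrite inE negb_or; apply/andP; split; first by rewrite !inE eqxx.
  by apply: contraTN (group1 L) => /notL.
- apply/setP=> z; rewrite !inE; apply/negP=> /andP[/andP[/eqP ntz Lz] /andP[_ Uz]].
  by case: ntz; apply: inLU.
- by apply/setP=> z; rewrite !inE; apply/negP=> /andP[/andP[_ Lz] /notL]; rewrite Lz.
by apply/setP=> z; rewrite !inE; apply/negP=> /andP[/andP[_ Uz] /notU]; rewrite Uz.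
Qed.

(** The three basic sets other than [[set 1]] have [#|K|] elements each, so
    [#|G| = 3 * #|K| + 1]. *)
Lemma prime_case : prime #|G| ->
  exists p : nat,
      [/\ prime p, (p %% 3 = 1)%N, #|G| = p
        & exists K : {group {perm gT}},
            [/\ K \subset Aut G, #|K| = (p.-1 %/ 3)%N
              & S = orbit 'P K @: G]].
Proof.
move=> pG; have [K [sKA oK defS]] := prime_Sring_cyclotomic SR pG.
have {}oK : #|G| = (3 * #|K| + 1)%N.
  by rewrite -(prednK (cardG_gt0 G)) -oK (_ : #|S| = 4) ?addn1.
exists #|G|; split=> //; first by rewrite oK mulnC modnMDl.
by exists K; split; rewrite // oK addn1 /= mulKn.
Qed.

(** * S-rings with a single nontrivial A-subgroup *)

Section UniqueSubgroup.
Variable L : {group gT}.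
Hypotheses (AL : is_Aset G S L) (ntL : 1 < #|L|) (pLG : L \proper G).
Hypothesis uniqL : forall H, is_Aset G S H -> [\/ H :=: 1, H :=: L | H :=: G].

Let sLG := proper_sub pLG.
Let nLG : L <| G. Proof. by rewrite -sub_abelian_normal. Qed.

Lemma card_inner_outer : #|basic_in S L| + #|S :\: basic_in S L| = 4.
Proof.
rewrite -rkS /srank -(cardsID (basic_in S L) S); congr (#|pred_of_set _| + _).
by apply/esym/setIidPr; apply/subsetP=> X; rewrite inE => /andP[].
Qed.

(** The restriction to [L] has rank 3 and no nontrivial A-subgroup, so [L] has prime order and the
    restriction is cyclotomic. One basic set remains to fill [G :\: L]. *)
Lemma rank3_sub_case : #|basic_in S L| = 3 ->
  exists p : nat,
      [/\ [/\ prime p, 3 <= p & #|L| = p],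
          (exists K : {group {perm gT}},
              [/\ K \subset Aut L, #|K| = (p.-1 %/ 2)%N
                & basic_in S L = orbit 'P K @: L]),
          wreath_cond S L
        & basic_quo S L G = [set [set 1]; (G / L)^#]].
Proof.
move=> rkL; have SRL := sub_Sring SR AL.
have pL : prime #|L|.
  apply: (primitive_prime SRL (cyclicS sLG cycG)); last by rewrite rkL.
  move=> H AH; have [->|->|HG] := uniqL (sub_Aset AL AH); [by left|by right|].
  by have := AH.1; rewrite HG => sGL; have := pLG; rewrite properE sGL andbF.
have [K [sKA oK defSL]] := prime_Sring_cyclotomic SRL pL; rewrite rkL in oK.
have {}oK : #|L| = (2 * #|K| + 1)%N by rewrite -(prednK (cardG_gt0 L)) -oK addn1.
have K0 : 0 < #|K| := cardG_gt0 K.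
have outer X : X \in S -> ~~ (X \subset L) -> X = G :\: L.
  move=> SX nXL; have rk1 : #|S :\: basic_in S L| = 1%N.
    by move: card_inner_outer; rewrite rkL => -[].
  have /cards1P[X0 defX0] : #|S :\: basic_in S L| == 1%N by rewrite rk1.
  have memX0 Y : Y \in S -> ~~ (Y \subset L) -> Y = X0.
    by move=> SY nYL; apply/set1P; rewrite -defX0 !inE SY nYL.
  apply/setP=> x; rewrite inE; apply/idP/andP=> [Xx | [nLx Gx]].
    rewrite (subsetP (basic_sub SR SX)) //; split=> //.
    by apply: contraNN nXL => /(Aset_sub AL SX Xx).
  have [Y SY Yx] := basic_cover SR Gx; rewrite (memX0 X) // -(memX0 Y) //.
  by apply: contraNN nLx => /subsetP->.
have cLX (X : {set gT}) : X \subset G -> L * X = X * L.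
  by move=> sXG; apply: centC; apply: subset_trans sLG (subset_trans cGG (centS sXG)).
have wrL : wreath_cond S L.
  move=> X SX nXL; have LX : L * X = X.
    apply/eqP; rewrite eqEsubset; apply/andP; split; last first.
      by apply/subsetP=> x Xx; rewrite -[x]mul1g mem_mulg.
    rewrite (outer X) //; apply/subsetP=> _ /mulsgP[h x Lh /setDP[Gx nLx] ->].
    by rewrite inE groupMl // nLx groupM // (subsetP sLG).
  by rewrite -cLX ?(basic_sub SR).
exists #|L|; split=> //; first by split=> //; rewrite oK addn1 ltnS leq_pmulr.
  by exists K; split; rewrite // oK addn1 /= mulKn.
have quoD : coset L @: (G :\: L) = (G / L)^#.
  have NG := subsetP (normal_norm nLG).
  apply/setP=> u; apply/imsetP/setD1P=> [[x /setDP[Gx nLx] ->] | [ntu /morphimP[x Nx Gx def_u]]].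
    split; last exact: mem_quotient.
    by apply: contraNN nLx => /eqP/coset_idr->; rewrite ?NG.
  exists x; rewrite // inE Gx andbT; apply: contraNN ntu => Lx.
  by rewrite def_u /= coset_id.
rewrite /basic_quo (basic_in_top SR); apply/setP=> Q; rewrite !inE; apply/imsetP/orP.
  case=> X SX ->; have [sXL | nXL] := boolP (X \subset L).
    by left; rewrite (coset_basic_sub SR).
  by right; rewrite (outer X SX nXL) quoD.
case=> /eqP->.
  by exists [set 1]; rewrite ?(basic1 SR) // (coset_basic_sub SR) ?(basic1 SR) ?sub1G.
have /properP[_ [g Gg nLg]] := pLG; have [X SX Xg] := basic_cover SR Gg.
have nXL : ~~ (X \subset L) by apply: contraNN nLg => /subsetP->.
by exists X; rewrite // (outer X SX nXL) quoD.
Qed.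

Lemma inner_rank2 : #|basic_in S L| = 2 -> basic_in S L = [set [set 1]; L^#].
Proof.
move=> rkL; have [x Lx ntx] : exists2 x, x \in L & x != 1 by apply/trivgPn; rewrite -cardG_gt1.
have SL1 : [set 1] \in basic_in S L by rewrite inE (basic1 SR) sub1G.
have block y : y \in L -> exists2 Y, Y \in basic_in S L & y \in Y.
  move=> Ly; have [Y SY Yy] := basic_cover SR (subsetP sLG y Ly).
  by exists Y; rewrite // inE SY (Aset_sub AL SY Yy Ly).
have [X SX Xx] := block x Lx.
have nX1 : [set 1] != X by apply: contraNneq ntx => X1; rewrite -X1 inE in Xx.
have defT : basic_in S L = [set [set 1]; X].
  by apply/esym/eqP; rewrite eqEcard subUset !sub1set SL1 SX cards2 nX1 rkL.
rewrite defT; suff -> : L^# = X by [].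
have [SX0 sXL] : X \in S /\ X \subset L by apply/andP; rewrite inE in SX.
apply/setP=> y; apply/setD1P/idP=> [[nty Ly]|Xy].
  have [Y + Yy] := block y Ly; rewrite defT !inE => /orP[] /eqP defY; rewrite defY // in Yy.
  by rewrite inE (negPf nty) in Yy.
split; last exact: (subsetP sXL).
by apply: contraNneq (basic_not1 SR SX0 _) => [<- //|]; rewrite eq_sym.
Qed.

(** Since [Y] is a union of [L]-cosets, so is [Z], its complement in [G :\: L]. The quotient by [L]
    then has rank 3 and no nontrivial A-subgroup. *)
Lemma wreath_quotient_case Y Z : 
    S :\: basic_in S L = [set Y; Z] -> Y != Z -> L \subset radical G Y ->
  exists p : nat,
      [/\ [/\ prime p, 3 <= p & #|G : L| = p],
          wreath_cond S L
        & exists K : {group {perm coset_of L}},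
              [/\ K \subset Aut (G / L), #|K| = (p.-1 %/ 2)%N
                & basic_quo S L G = orbit 'P K @: (G / L)]].
Proof.
move=> outS nYZ radY.
have outP X : (X == Y) || (X == Z) = (X \in S) && ~~ (X \subset L).
  by rewrite -in_set2 -outS !inE; case: (X \in S); rewrite ?andbT ?andbF.
have /andP[SY nYL] : (Y \in S) && ~~ (Y \subset L) by rewrite -outP eqxx.
have /andP[SZ nZL] : (Z \in S) && ~~ (Z \subset L) by rewrite -outP eqxx orbT.
have LY : L * Y = Y by apply: radical_lcoset radY.
have cLX (X : {set gT}) : X \subset G -> L * X = X * L.
  by move=> sXG; apply: centC; apply: subset_trans sLG (subset_trans cGG (centS sXG)).
have radZ : L \subset radical G Z.
  apply: sub_radical => // h z Lh Zz; have Gz := subsetP (basic_sub SR SZ) z Zz.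
  have Gh := subsetP sLG h Lh; have [X SX Xhz] := basic_cover SR (groupM Gh Gz).
  have : (X == Y) || (X == Z).
    rewrite outP SX; apply: contraNN nZL => /subsetP/(_ _ Xhz); rewrite groupMl //.
    exact: Aset_sub AL SZ Zz.
  case/orP=> /eqP defX; rewrite defX in Xhz; last by [].
  have Yz : z \in Y by rewrite -LY -(mulKg h z) mem_mulg ?groupV.
  by case/eqP: nYZ; apply: (basic_eq SR SY SZ Yz Zz).
have wrL : wreath_cond S L.
  move=> X SX nXL; have LX : L * X = X.
    have : (X == Y) || (X == Z) by rewrite outP SX.
    by case/orP=> /eqP-> //; apply: radical_lcoset radZ.
  by rewrite -cLX ?(basic_sub SR).
have SRq := quotient_Sring SR AL nLG wrL.
have rkq : #|basic_quo S L G| = 3.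
  have -> : basic_quo S L G = [set [set 1]; coset L @: Y; coset L @: Z].
    rewrite /basic_quo (basic_in_top SR); apply/setP=> Q; rewrite !inE; apply/imsetP/idP.
      case=> X SX ->; have [sXL | nXL] := boolP (X \subset L).
        by rewrite (coset_basic_sub SR) ?eqxx.
      have : (X == Y) || (X == Z) by rewrite outP SX.
      by case/orP=> /eqP->; rewrite eqxx ?orbT.
    rewrite -orbA => /or3P[] /eqP->; [|by exists Y|by exists Z].
    by exists [set 1]; rewrite ?(basic1 SR) // (coset_basic_sub SR) ?(basic1 SR) ?sub1G.
  rewrite -setUA !cardsU1 cards1 !inE negb_or.
  rewrite ![[set 1] == _]eq_sym !(coset_basic_neq1 SR nLG) //=.
  rewrite (_ : _ == _ = false) //; apply: contraNF nYZ => /eqP eqYZ; apply/eqP.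
  by rewrite -(coset_basic_pre SR nLG wrL SY nYL) eqYZ (coset_basic_pre SR nLG wrL).
have pq : prime #|G / L|.
  apply: (primitive_prime SRq (quotient_cyclic L cycG)); last by rewrite rkq.
  move=> Q AQ; have AH := quotient_Aset_pre SR nLG AQ.
  have Qpre : coset L @*^-1 Q / L = Q by rewrite cosetpreK.
  have [H1|HL|HG] := uniqL AH.
  - by left; rewrite -Qpre H1 quotient1.
  - by left; rewrite -Qpre HL trivg_quotient.
  by right; rewrite -Qpre HG.
have [K [sKA oK defSL]] := prime_Sring_cyclotomic SRq pq; rewrite rkq in oK.
have {}oK : #|(G / L)%G| = (2 * #|K| + 1)%N by rewrite -(prednK (cardG_gt0 (G / L)%G)) -oK addn1.
have K0 : 0 < #|K| := cardG_gt0 K.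
have iGL : #|G : L| = #|(G / L)%G| by rewrite card_quotient ?normal_norm.
have p3 : 3 <= #|(G / L)%G| by rewrite oK addn1 ltnS leq_pmulr.
exists #|G : L|; rewrite iGL; split; [by split | exact: wrL | exists K].
by split; [exact: sKA | rewrite oK addn1 /= mulKn | exact: defSL].
Qed.

End UniqueSubgroup.
End RankFour.

(** * Assembly of the six cases *)

Unset Implicit Arguments. Set Strict Implicit. Set Printing Implicit Defensive.

Theorem theorem6p1 (gT : finGroupType) (G : {group gT}) (S : {set {set gT}}) :
  cyclic G -> is_Sring G S -> srank S = 4 ->
  (* (1) T_L (x) T_U *)
  (exists L U : {group gT},
      [/\ Asubgroup S L /\ Asubgroup S U,
          1 < #|L| /\ L \proper G, 1 < #|U| /\ U \proper G,
          L \x U = G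
        & S = [set [set 1]; L^#; U^#; L^# * U^#]])
  \/
  (* (2) (T_L wr T_{U/L}) wr T_{G/U} *)
  (exists L U : {group gT},
      [/\ Asubgroup S L /\ Asubgroup S U,
          1 < #|L|, L \proper U, U \proper G
        & S = [set [set 1]; L^#; U :\: L; G :\: U]])
  \/
  (* (3) Cyc((p-1)/2, L) wr T_{G/L}, |L| = p prime >= 3 *)
  (exists (L : {group gT}) (p : nat),
      [/\ Asubgroup S L /\ L \proper G, [/\ prime p, 3 <= p & #|L| = p],
          (exists K : {group {perm gT}},
              [/\ K \subset Aut L, #|K| = (p.-1 %/ 2)%N
                & basic_in S L = orbit 'P K @: L]),
          wreath_cond S L
        & basic_quo S L G = [set [set 1]; (G / L)^#]])
  \/
  (* (4) T_L wr Cyc((p-1)/2, G/L), |G : L| = p prime >= 3 *)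
  (exists (L : {group gT}) (p : nat),
      [/\ [/\ Asubgroup S L, 1 < #|L| & L \proper G],
          [/\ prime p, 3 <= p & #|G : L| = p],
          basic_in S L = [set [set 1]; L^#],
          wreath_cond S L
        & exists K : {group {perm coset_of L}},
              [/\ K \subset Aut (G / L), #|K| = (p.-1 %/ 2)%N
                & basic_quo S L G = orbit 'P K @: (G / L)]])
  \/
  (* (5) |G| = p prime, p = 1 mod 3, A = Cyc((p-1)/3, G) *)
  (exists p : nat,
      [/\ prime p, (p %% 3 = 1)%N, #|G| = p
        & exists K : {group {perm gT}},
            [/\ K \subset Aut G, #|K| = (p.-1 %/ 3)%N
              & S = orbit 'P K @: G]])
  \/
  (* (6) |G| = 4, A = ZG *)
  ((#|G| = 4)%N /\ S = [set [set x] | x in G]).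
Proof.
move=> cycG SR rkS.
(* A boolean form of being a nontrivial A-subgroup, so that [pickP] can search the finite type of
   subgroups. *)
pose nontriv (H : {group gT}) :=
  [&& (H : {set gT}) == cover [set X in S | X \subset H], 1 < #|H| & H \proper G].
have ntP H : nontriv H -> [/\ Asubgroup S H, is_Aset G S H, 1 < #|H| & H \proper G].
  by case/and3P=> /eqP AH ntH pHG; split=> //; apply/(Asubgroup_Aset SR).
have ntI (H : {group gT}) : is_Aset G S H -> [\/ H :=: 1, nontriv H | H :=: G].
  move=> AH; have [H1 | ntH] := eqVneq (H : {set gT}) 1; first by apply: Or31.
  have [HG | nHG] := eqVneq (H : {set gT}) G; first by apply: Or33.
  apply: Or32; rewrite /nontriv cardG_gt1 ntH properEneq nHG AH.1 !andbT.
  exact/eqP/(Asubgroup_Aset SR).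
have [L ntL | no_nt] := pickP nontriv; last first.
  do 4!right; left; apply: prime_case => //.
  apply: (primitive_prime SR cycG); last by rewrite (_ : #|S| = 4).
  by move=> H AH; have [H1 | ntH | HG] := ntI H AH; [left | rewrite no_nt in ntH | right].
have [SL AL L1 pLG] := ntP L ntL.
have chain (U V : {group gT}) : nontriv U -> nontriv V -> U \proper V ->
    exists L U : {group gT}, [/\ Asubgroup S L /\ Asubgroup S U,
      1 < #|L|, L \proper U, U \proper G
      & S = [set [set 1]; L^#; U :\: L; G :\: U]].
  move=> /ntP[SU AU U1 _] /ntP[SV AV _ pVG] pUV; exists U, V; split=> //.
  exact: chain_case.
(* With a second nontrivial A-subgroup [U], a chain arises from [L] and [U], from [L :&: U] and [L],
   or from [U] and [L <*> U], unless [L] and [U] are complementary. *)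
have [U /andP[ntU nUL] | noU] := pickP [pred U : {group gT} | nontriv U & U != L].
  have [SU AU U1 pUG] := ntP U ntU.
  have cLU : L * U = U * L.
    apply: centC; apply: subset_trans (proper_sub pLG) _.
    exact: subset_trans (cyclic_abelian cycG) (centS (proper_sub pUG)).
  have AJ : is_Aset G S (L <*> U)%G by rewrite /= comm_joingE //; apply: AsetM.
  have nUL' : (U : {set gT}) != L by apply: contraNneq nUL => /group_inj->.
  have [sLU | nsLU] := boolP (L \subset U).
    by right; left; apply: (chain L U) => //; rewrite properEneq eq_sym nUL'.
  have [tiLU | ntLU | LUG] := ntI (L :&: U)%G (AsetI AL AU).
  - have [LU1 | ntLU | LUG] := ntI (L <*> U)%G AJ.
    + case/negP: nsLU; apply: subset_trans (joing_subl L U) _.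
      by rewrite /= in LU1; rewrite LU1 sub1G.
    + right; left; apply: (chain U (L <*> U)%G) => //.
      rewrite properE /= joing_subr; apply: contraNN nsLU.
      by apply: subset_trans; apply: joing_subl.
    left; exists L, U; split=> //; last exact: (tensor_case SR rkS AL AU L1 U1 tiLU).
    rewrite dprodE //; first by rewrite -comm_joingE.
    apply: subset_trans (proper_sub pUG) _.
    exact: subset_trans (cyclic_abelian cycG) (centS (proper_sub pLG)).
  - right; left; apply: (chain (L :&: U)%G L) => //.
    by rewrite properE /= subsetIl subsetI subxx.
  case/negP: nsLU; apply: subset_trans (proper_sub pLG) _.
  by rewrite -LUG /= subsetIr.
have uniqL (H : {group gT}) : is_Aset G S H -> [\/ H :=: 1, H :=: L | H :=: G].
  move=> AH; have [H1 | ntH | HG] := ntI H AH; [exact: Or31 | | exact: Or33].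
  by have := noU H; rewrite /= ntH /= => /negbFE/eqP->; apply: Or32.
have rk_out : 0 < #|S :\: basic_in S L|.
  have /properP[_ [g Gg nLg]] := pLG; have [X SX Xg] := basic_cover SR Gg.
  apply/card_gt0P; exists X; rewrite !inE SX andbT.
  by apply: contraNN nLg => /subsetP->.
have rk_in : 1 < #|basic_in S L|.
  have [x Lx ntx] : exists2 x, x \in L & x != 1 by apply/trivgPn; rewrite -cardG_gt1.
  have [X SX Xx] := basic_cover SR (subsetP (proper_sub pLG) x Lx).
  apply/card_gt1P; exists [set 1], X; split.
  - by rewrite inE (basic1 SR) sub1G.
  - by rewrite inE SX (Aset_sub AL SX Xx Lx).
  by apply: contraNneq ntx => X1; rewrite -X1 inE in Xx.
have rk_sum := card_inner_outer rkS L.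
have [rk3 | rk2] : #|basic_in S L| = 3 \/ #|basic_in S L| = 2.
  have: #|basic_in S L| < 4 by rewrite -rk_sum -[X in X < _]addn0 ltn_add2l.
  case: #|basic_in S L| rk_in => [|[|[|[|n]]]] // _ _; [by right | by left].
  do 2!right; left.
  have [p [pL exK wrL quoL]] := rank3_sub_case SR cycG rkS AL pLG uniqL rk3.
  by exists L, p; split.
have /cards2P[Y [Z [nYZ outS]]] : #|S :\: basic_in S L| == 2%N.
  by rewrite rk2 in rk_sum; case: rk_sum => <-.
have inS := inner_rank2 SR AL L1 pLG rk2.
(* Whether [Y] is a union of [L]-cosets separates case (4) from case (6). *)
have [radY | nradY] := boolP (L \subset radical G Y).
  do 3!right; left.
  have [p [pq wrL exK]] := wreath_quotient_case SR cycG AL pLG uniqL outS nYZ radY.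
  by exists L, p; split.
do 5!right; have defS : S = [set [set 1]; L^#; Y; Z].
  rewrite -(setID S (basic_in S L)) outS -setUA -inS; congr (_ :|: _).
  by apply/setIidPr/subsetP=> X; rewrite inE => /andP[].
have nL X : X \in [set Y; Z] -> ~~ (X \subset L).
  by rewrite -outS !inE => /andP[+ SX]; rewrite SX.
by apply: (trivial_radical_Z4 SR cycG rkS AL L1 uniqL defS); rewrite ?nL ?inE ?eqxx ?orbT.
Qed.
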